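(* Any smooth positive solution $v:\mathbb{R}^4\to(0,\infty)$ of the equation $$\Delta v=-2v^3\quad\text{on }\mathbb{R}^4$$ is one of the functions in the family $$v_{\delta,x_0}(x)=\frac{2\delta}{\delta^2+|x-x_0|^2},\qquad (x_0,\delta)\in\mathbb{R}^4\times(0,\infty).$$
   Context: $\Delta=\mathrm{div}\,\mathrm{grad}$ is the Euclidean Laplacian (negative spectrum) on $\mathbb{R}^4$. *)

(* Defs.v *)
(* MathComp-Analysis: R^n is 'rV[R]_n for an arbitrary R : realType. *)
From HB Require Import structures.
From mathcomp Require Import all_boot all_order all_algebra.
From mathcomp Require Import all_classical all_reals all_analysis.
Set Implicit Arguments.
Unset Strict Implicit.
Unset Printing Implicit Defensive.
Import Order.TTheory GRing.Theory Num.Theory.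
Import numFieldNormedType.Exports.
Local Open Scope classical_set_scope.
Local Open Scope ring_scope.

Section EuclideanCalculus.
Variables (R : realType) (n : nat).
Implicit Types (f : 'rV[R]_n -> R) (F : 'rV[R]_n -> 'rV[R]_n).

(* The library norm `|x| on 'rV[R]_n is the sup norm, hence this definition;
   both norms induce the same topology and the same derivatives. *)
Definition enorm (x : 'rV[R]_n) : R := Num.sqrt (\sum_(i < n) x 0 i ^+ 2).

Definition partial (i : 'I_n) f : 'rV[R]_n -> R :=
  fun x => 'D_(delta_mx 0 i) f x.

Definition iter_partial (s : seq 'I_n) f : 'rV[R]_n -> R :=
  foldr partial f s.

(* 'D_v f x has a junk value when the limit does not exist, so existence of
   each partial derivative has to be required separately. *)
Definition smooth f : Prop :=
  forall s : seq 'I_n,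
    continuous (iter_partial s f) /\
    forall (i : 'I_n) (x : 'rV[R]_n),
      derivable (iter_partial s f) x (delta_mx 0 i).

Definition grad f : 'rV[R]_n -> 'rV[R]_n :=
  fun x => \row_(i < n) partial i f x.

Definition divergence F : 'rV[R]_n -> R :=
  fun x => \sum_(i < n) partial i (fun y => F y 0 i) x.

Definition laplacian f : 'rV[R]_n -> R := divergence (grad f).

End EuclideanCalculus.

Definition bubble (R : realType) (n : nat) (delta : R) (x0 : 'rV[R]_n) :
    'rV[R]_n -> R :=
  fun x => 2 * delta / (delta ^+ 2 + enorm (x - x0) ^+ 2).

(* Main.v *)
Require Import Defs.
From HB Require Import structures.
From mathcomp Require Import all_boot all_order all_algebra.
From mathcomp Require Import all_classical all_reals all_analysis.
From mathcomp Require Import ring lra.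
Set Implicit Arguments.
Unset Strict Implicit.
Unset Printing Implicit Defensive.
Import Order.TTheory GRing.Theory Num.Theory.
Import numFieldNormedType.Exports.
Local Open Scope classical_set_scope.
Local Open Scope ring_scope.

(* Put w = 1/v and P = Lap w. The equation for v reads w P = 2 |grad w|^2 + 2, and
   differentiating it twice gives, with E the traceless part of the Hessian of w,
     w grad P = 4 E grad w   and   div (w^-2 grad P) = 4 w^-3 |E|^2 >= 0.
   Since E is traceless, |E grad w|^2 <= 3/4 |E|^2 |grad w|^2; hence S = sqrt P satisfies
     div (w^-2 grad S) >= 1/3 w^-2 |grad S|^2 / S.
   Test this against psi^5, where psi = prod_i (1 - x_i^2 / r^2) vanishes on the boundary of
   the cube [-r, r]^4. The error term is controlled by r^-2 times the integral of psi^3 v^2 S,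
   and v^2 S = sqrt (v P * v^3), where testing the equations for v and for ln v yields
   int psi^3 v^3 = O(r) and int psi^2 v P = O(r^2). So the integral of
   psi^5 w^-2 |grad S|^2 / S is O(r^(-1/2)); as r grows, S is constant, E = 0,
   and w is a quadratic polynomial with Hessian (P/4) Id. *)

(** * Functions of class C^k *)

(** The reciprocal of a bubble is (delta^2 + |x - x0|^2) / (2 delta), whose Hessian is a multiple of
    Id; thus E measures the deviation of v from the family. The factor 3/4 is decisive: with the
    plain bound |E grad w|^2 <= |E|^2 |grad w|^2 the same computation yields only div (w^-2 grad S)
    >= 0, and the traceless refinement supplies exactly the missing 1/3. The square root is taken
    because the error for P itself would contain v^2 P, which is no product of powers of v P and v^3
    with exponents summing to 1, whereas v^2 S is their geometric mean. Cubes serve instead of balls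
    because the integral over a cube is an iteration of one-variable integrals: the divergence
    theorem reduces to the fundamental theorem of calculus in one coordinate and differentiation
    under the integral sign in the others. *)

Section Slices.
Variables (R : realType) (n : nat).
Implicit Types (f g : 'rV[R]_n -> R) (x v : 'rV[R]_n) (i j : 'I_n).

(** The two difference quotients are the same function of the increment. One-variable results (mean
    value theorem, fundamental theorem, chain rule) thereby apply along every line. *)
Lemma slice_derive f x v (t : R) (d : R) :
  is_derive (t *: v + x) v f d <-> is_derive t 1 (fun h : R => f (h *: v + x)) d.
Proof.
have E : (fun h : R => h^-1 *: ((f \o shift (t *: v + x)) (h *: v) - f (t *: v + x)))
   = (fun h : R => h^-1 *: (((fun h : R => f (h *: v + x)) \o shift t) (h *: 1)
        - f (t *: v + x))).
  apply/funext => h /=; rewrite addrA -scalerDl.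
  by rewrite [h *: 1]mulr1.
split=> -[d1 d2]; split.
- by move: d1; rewrite /derivable E.
- by move: d2; rewrite /derive E.
- by move: d1; rewrite /derivable -E.
- by move: d2; rewrite /derive -E.
Qed.

(** Written as a translation along a basis vector rather than by cases on the index, so that
    [slice_derive] applies; [updE] recovers the description by coordinates. *)
Definition upd x i (t : R) : 'rV[R]_n := (t - x 0 i) *: delta_mx 0 i + x.

Lemma updE x i t j : upd x i t 0 j = if j == i then t else x 0 j.
Proof.
rewrite /upd !mxE eqxx /=; case: eqP => [->|_]; first by rewrite mulr1 subrK.
by rewrite mulr0 add0r.
Qed.

Lemma upd_id x i : upd x i (x 0 i) = x.
Proof. by rewrite /upd subrr scale0r add0r. Qed.

Lemma updC x i j s t : i != j -> upd (upd x i s) j t = upd (upd x j t) i s.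
Proof.
move=> ij; apply/rowP => k; rewrite !updE.
by have [->|//] := eqVneq k j; rewrite eq_sym (negbTE ij).
Qed.

Lemma upd_upd x i s t : upd (upd x i s) i t = upd x i t.
Proof. by apply/rowP => k; rewrite !updE; case: eqP. Qed.

Lemma upd_derive f x i t d :
  is_derive (upd x i t) (delta_mx 0 i) f d <-> is_derive t 1 (fun h : R => f (upd x i h)) d.
Proof.
have E h : upd x i h = h *: delta_mx 0 i + (x - x 0 i *: delta_mx 0 i).
  by rewrite /upd scalerBl addrAC addrA.
under [X in is_derive t 1 X d]eq_fun do rewrite E.
by rewrite E; exact: slice_derive.
Qed.

End Slices.

Section Ck.
Variables (R : realType) (n : nat).
Implicit Types (f g : 'rV[R]_n -> R) (x v : 'rV[R]_n) (i j : 'I_n) (k : nat).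

Local Notation e_ i := (delta_mx 0 i : 'rV[R]_n).

Lemma cont_add f g : continuous f -> continuous g -> continuous (fun x => f x + g x).
Proof. by move=> cf cg x; exact: (continuousD (cf x) (cg x)). Qed.

Lemma cont_mul f g : continuous f -> continuous g -> continuous (fun x => f x * g x).
Proof. by move=> cf cg x; exact: (continuousM (cf x) (cg x)). Qed.

Lemma cont_inv f : (forall x, f x != 0) -> continuous f -> continuous (fun x => (f x)^-1).
Proof. by move=> f0 cf x; exact: (@cvgV _ _ (nbhs x) _ f (f x) (f0 x) (cf x)). Qed.

(** Recursion on the order suits closure proofs: an induction on [k] for products, inverses and
    roots spends one derivative at a time, unlike the quantification over all words in [smooth]. *)
Fixpoint Ck k f : Prop :=
  continuous f /\
  if k is k'.+1 then
    forall i, (forall x, derivable f x (e_ i)) /\ Ck k' (partial i f)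
  else True.

Lemma smooth_Ck f : smooth f -> forall k, Ck k f.
Proof.
move=> sf k; suff H : forall s, Ck k (iter_partial s f) by exact: (H [::]).
elim: k => [|k IH] s; first by split => //; exact: (sf s).1.
split; first exact: (sf s).1.
by move=> i; split; [exact: (sf s).2|exact: (IH (i :: s))].
Qed.

Lemma Ck_continuous k f : Ck k f -> continuous f.
Proof. by case: k => [|k] []. Qed.

Lemma CkS k f : Ck k.+1 f -> Ck k f.
Proof.
elim: k f => [|k IH] f [cf df]; split => // i.
by have [d1 d2] := df i; split => //; exact: IH.
Qed.

Lemma Ck_partial k f i : Ck k.+1 f -> Ck k (partial i f).
Proof. by case=> _ /(_ i)[]. Qed.

Lemma Ck_is_derive k f x i : Ck k.+1 f -> is_derive x (e_ i) f (partial i f x).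
Proof. by move=> [_ /(_ i)[d _]]; split. Qed.

Lemma partial_val f x i d : is_derive x (e_ i) f d -> partial i f x = d.
Proof. by case. Qed.

Lemma CkI k f (df : 'I_n -> 'rV[R]_n -> R) : continuous f ->
  (forall i x, is_derive x (e_ i) f (df i x)) -> (forall i, Ck k (df i)) -> Ck k.+1 f.
Proof.
move=> cf dfE dfk; split => // i; split => [x|]; first by have [] := dfE i x.
have -> // : partial i f = df i by apply/funext => x; exact: partial_val.
Qed.

Lemma is_derive_const (c : R) x v : is_derive x v (fun=> c) 0.
Proof. exact: is_derive_cst. Qed.

Lemma is_derive_add f g x v a b : is_derive x v f a -> is_derive x v g b ->
  is_derive x v (fun y => f y + g y) (a + b).
Proof. by move=> fa gb; exact: is_deriveD. Qed.

Lemma is_derive_mul f g x v a b : is_derive x v f a -> is_derive x v g b ->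
  is_derive x v (fun y => f y * g y) (a * g x + f x * b).
Proof.
move=> fa gb; have := is_deriveM fa gb.
by move=> H; apply: is_derive_eq; rewrite addrC /GRing.scale /= [g x * a]mulrC.
Qed.

Lemma is_derive_bigsum m (F : 'I_m -> 'rV[R]_n -> R) (dF : 'I_m -> R) x v :
  (forall a, is_derive x v (F a) (dF a)) ->
  is_derive x v (fun y => \sum_i F i y) (\sum_i dF i).
Proof.
move=> H; elim: (index_enum _) => [|a s IH].
  by under eq_fun do rewrite big_nil; rewrite big_nil; exact: is_derive_const.
by under eq_fun do rewrite big_cons; rewrite big_cons; exact: is_derive_add.
Qed.

Lemma is_derive_exp f m x v a : is_derive x v f a ->
  is_derive x v (fun y => f y ^+ m.+1) (m.+1%:R * f x ^+ m * a).
Proof.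
move=> fa; elim: m => [|m IH].
  by under eq_fun do rewrite expr1; rewrite mulr1 mul1r.
under eq_fun do rewrite exprS.
apply: (is_derive_eq (is_derive_mul fa IH)).
by rewrite [m.+2%:R]mulrS exprS; ring.
Qed.

Lemma is_derive_inv f x v a : f x != 0 -> is_derive x v f a ->
  is_derive x v (fun y => (f y)^-1) (- (a * ((f x)^-1 * (f x)^-1))).
Proof.
move=> f0 [df da]; split; first exact: derivableV.
by rewrite deriveV// da /GRing.scale /= mulNr mulrC expr2 invfM.
Qed.

Lemma is_derive_sqrt f x v a : 0 < f x -> is_derive x v f a ->
  is_derive x v (fun y => Num.sqrt (f y)) (a * (2 * Num.sqrt (f x))^-1).
Proof.
move=> f0 fa.
have : is_derive (0 *: v + x) v f a by rewrite scale0r add0r.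
move/slice_derive => fa'.
suff: is_derive (0 *: v + x) v (fun y => Num.sqrt (f y)) (a * (2 * Num.sqrt (f x))^-1).
  by rewrite scale0r add0r.
apply/slice_derive.
have s0 : is_derive (f (0 *: v + x)) 1 Num.sqrt (2 * Num.sqrt (f x))^-1.
  by rewrite scale0r add0r; exact: is_derive1_sqrt.
have H := is_derive1_comp s0 fa'.
by apply: is_derive_eq; rewrite mulrC.
Qed.

Lemma is_derive_coord x i j : is_derive x (e_ i) (fun y => y 0 j) ((j == i)%:R).
Proof.
rewrite -{1}(upd_id x i); apply/upd_derive.
under eq_fun do rewrite updE.
by case: (j == i); [exact: (@is_derive_id R R^o)|exact: (@is_derive_cst R R^o R^o)].
Qed.

Lemma Ck_cst k (c : R) : Ck k (fun=> c).
Proof.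
elim: k c => [|k IH] c; first by split => //; exact: cst_continuous.
apply: (@CkI _ _ (fun _ _ => 0)) => //; exact: cst_continuous.
Qed.

Lemma Ck_coord k j : Ck k (fun x => x 0 j).
Proof.
case: k => [|k]; first by split => //; exact: coord_continuous.
apply: (@CkI _ _ (fun i _ => (j == i)%:R)); first exact: coord_continuous.
  by move=> i x; exact: is_derive_coord.
by move=> i; exact: Ck_cst.
Qed.

Lemma Ck_add k f g : Ck k f -> Ck k g -> Ck k (fun x => f x + g x).
Proof.
elim: k f g => [|k IH] f g Hf Hg.
  by split => //; exact: cont_add (Ck_continuous Hf) (Ck_continuous Hg).
apply: (@CkI _ _ (fun i x => partial i f x + partial i g x)).
- exact: cont_add (Ck_continuous Hf) (Ck_continuous Hg).
- move=> i x; apply: is_derive_add; [exact: Ck_is_derive Hf|exact: Ck_is_derive Hg].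
- by move=> i; apply: IH; exact: Ck_partial.
Qed.

Lemma Ck_mul k f g : Ck k f -> Ck k g -> Ck k (fun x => f x * g x).
Proof.
elim: k f g => [|k IH] f g Hf Hg.
  by split => //; exact: cont_mul (Ck_continuous Hf) (Ck_continuous Hg).
apply: (@CkI _ _ (fun i x => partial i f x * g x + f x * partial i g x)).
- exact: cont_mul (Ck_continuous Hf) (Ck_continuous Hg).
- move=> i x; apply: is_derive_mul; [exact: Ck_is_derive Hf|exact: Ck_is_derive Hg].
- move=> i; apply: Ck_add; apply: IH.
  + exact: Ck_partial.
  + exact: CkS Hg.
  + exact: CkS Hf.
  + exact: Ck_partial.
Qed.

Lemma Ck_opp k f : Ck k f -> Ck k (fun x => - f x).
Proof.
move=> Hf; have -> : (fun x => - f x) = (fun x => -1 * f x).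
  by apply/funext => x; rewrite mulN1r.
by apply: Ck_mul => //; exact: Ck_cst.
Qed.

Lemma Ck_sum k (I : Type) (r : seq I) (F : I -> 'rV[R]_n -> R) :
  (forall a, Ck k (F a)) -> Ck k (fun x => \sum_(a <- r) F a x).
Proof.
move=> HF; elim: r => [|a r IH].
  by under eq_fun do rewrite big_nil; exact: Ck_cst.
by under eq_fun do rewrite big_cons; exact: Ck_add.
Qed.

Lemma Ck_prod k (I : Type) (r : seq I) (P : pred I) (F : I -> 'rV[R]_n -> R) :
  (forall a, Ck k (F a)) -> Ck k (fun x => \prod_(a <- r | P a) F a x).
Proof.
move=> HF; elim: r => [|a r IH].
  by under eq_fun do rewrite big_nil; exact: Ck_cst.
under eq_fun do rewrite big_cons.
by case: (P a) => //; exact: Ck_mul.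
Qed.

Lemma Ck_exp k f m : Ck k f -> Ck k (fun x => f x ^+ m).
Proof.
move=> Hf; elim: m => [|m IH].
  by under eq_fun do rewrite expr0; exact: Ck_cst.
by under eq_fun do rewrite exprS; exact: Ck_mul.
Qed.

Lemma Ck_inv k f : (forall x, f x != 0) -> Ck k f -> Ck k (fun x => (f x)^-1).
Proof.
move=> f0; elim: k => [|k IH] Hf.
  by split => //; exact: cont_inv (Ck_continuous Hf).
apply: (@CkI _ _ (fun i x => - (partial i f x * ((f x)^-1 * (f x)^-1)))).
- exact: cont_inv (Ck_continuous Hf).
- by move=> i x; apply: is_derive_inv => //; exact: Ck_is_derive Hf.
- move=> i; apply/Ck_opp/Ck_mul; first exact: Ck_partial.
  by apply: Ck_mul; apply: IH; exact: CkS Hf.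
Qed.

Lemma Ck_sqrt k f : (forall x, 0 < f x) -> Ck k f -> Ck k (fun x => Num.sqrt (f x)).
Proof.
move=> f0; have s0 x : 2 * Num.sqrt (f x) != 0.
  by rewrite mulf_neq0 ?pnatr_eq0// gt_eqF// sqrtr_gt0.
have cs : continuous f -> continuous (fun x => Num.sqrt (f x)).
  by move=> cf x; apply: (continuous_comp (cf x)); exact: sqrt_continuous.
elim: k => [|k IH] Hf.
  by split => //; exact: (cs (Ck_continuous Hf)).
apply: (@CkI _ _ (fun i x => partial i f x * (2 * Num.sqrt (f x))^-1)).
- exact: (cs (Ck_continuous Hf)).
- by move=> i x; apply: is_derive_sqrt => //; exact: Ck_is_derive Hf.
- move=> i; apply: Ck_mul; first exact: Ck_partial.
  apply: Ck_inv => //; apply: Ck_mul; first exact: Ck_cst.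
  by apply: IH; exact: CkS Hf.
Qed.

End Ck.

(** * Symmetry of second derivatives *)

Section MeanValue.
Variables (R : realType) (n : nat).
Implicit Types (f g : 'rV[R]_n -> R) (x v : 'rV[R]_n) (i j : 'I_n).

Lemma continuous_rV_dist f x (e : R) : continuous f -> 0 < e ->
  exists2 d : R, 0 < d &
    forall y : 'rV[R]_n, (forall k : 'I_n, `|x 0 k - y 0 k| < d) -> `|f x - f y| < e.
Proof.
move=> cf e0; have /cvgrPdist_lt/(_ e e0) := cf x.
move=> /nbhs_ballP[d /= d0 H]; exists d => // y xy; apply: H.
by split => // a b; rewrite !ord1; exact: xy.
Qed.

Lemma is_derive_mvt (g dg : R -> R) (a b : R) : a < b ->
  (forall t : R, is_derive t 1 g (dg t)) ->
  exists2 c, a <= c <= b & g b - g a = dg c * (b - a).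
Proof.
move=> ab dgE; have [|c cab ->] := @MVT R g dg a b ab.
  apply: continuous_subspaceT => t.
  by apply/differentiable_continuous/derivable1_diffP; case: (dgE t).
by exists c => //; move: cab; rewrite in_itv /= => /andP[/ltW -> /ltW ->].
Qed.

Lemma Ck_upd_derive (k : nat) f x i (t : R) : Ck k.+1 f ->
  is_derive t 1 (fun h : R => f (upd x i h)) (partial i f (upd x i t)).
Proof. by move=> cf; apply/upd_derive; exact: Ck_is_derive cf. Qed.

(** Two mean value theorems: one in coordinate [i] for the difference [G] of [f] at two levels of
    coordinate [j], then one in coordinate [j] for the derivative so obtained. *)
Lemma second_difference f x i j (h : R) : i != j -> 0 < h -> Ck 2 f ->
  exists c d, [/\ x 0 i <= c <= x 0 i + h, x 0 j <= d <= x 0 j + h &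
   f (upd (upd x i (x 0 i + h)) j (x 0 j + h)) - f (upd x i (x 0 i + h))
   - f (upd x j (x 0 j + h)) + f x =
     h * h * partial j (partial i f) (upd (upd x i c) j d)].
Proof.
move=> ij h0 cf; set s := x 0 j + h.
pose G t := f (upd (upd x j s) i t) - f (upd x i t).
pose dG t := partial i f (upd (upd x j s) i t) - partial i f (upd x i t).
have [||c cb EG] := @is_derive_mvt G dG (x 0 i) (x 0 i + h).
- by rewrite ltrDl.
- by move=> t; apply: is_deriveB; exact: Ck_upd_derive cf.
have [||d db EH] := @is_derive_mvt (fun t => partial i f (upd (upd x i c) j t))
  (fun t => partial j (partial i f) (upd (upd x i c) j t)) (x 0 j) s.
- by rewrite ltrDl.
- by move=> t; exact: Ck_upd_derive (Ck_partial i cf).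
exists c, d; split => //.
have xji : upd x i c 0 j = x 0 j by rewrite updE eq_sym (negbTE ij).
have Ec : upd (upd x i c) j (x 0 j) = upd x i c by rewrite -[in X in upd _ _ X]xji upd_id.
have xij : upd x j s 0 i = x 0 i by rewrite updE (negbTE ij).
have Es : upd (upd x j s) i (x 0 i) = upd x j s by rewrite -[in X in upd _ _ X]xij upd_id.
move: EG EH; rewrite /G /dG Ec Es upd_id -!(updC x _ s ij) -/s {2}/s.
rewrite [x 0 i + h - _]addrAC [x 0 j + h - _]addrAC !subrr !add0r => EG EH.
rewrite EH in EG; lra.
Qed.

Lemma upd2_near x i j (a b h d : R) : x 0 i <= a <= x 0 i + h ->
  x 0 j <= b <= x 0 j + h -> h < d -> 0 < d ->
  forall k : 'I_n, `|x 0 k - upd (upd x i a) j b 0 k| < d.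
Proof.
move=> /andP[a1 a2] /andP[b1 b2] hd d0 k; rewrite !updE.
case: eqP => [->|_]; first by rewrite distrC ger0_norm ?subr_ge0//; lra.
case: eqP => [->|_]; first by rewrite distrC ger0_norm ?subr_ge0//; lra.
by rewrite subrr normr0.
Qed.

(** The second difference over a square of side [h] is symmetric in [i] and [j], so the two mixed
    derivatives agree at some pair of points of the square; their continuity closes the gap for
    small [h]. *)
Theorem schwarz f i j x : Ck 2 f ->
  partial j (partial i f) x = partial i (partial j f) x.
Proof.
move=> cf; have [->//|ij] := eqVneq i j.
have c1 : continuous (partial j (partial i f)).
  by apply: (@Ck_continuous _ _ 0); do 2 apply: Ck_partial.
have c2 : continuous (partial i (partial j f)).
  by apply: (@Ck_continuous _ _ 0); do 2 apply: Ck_partial.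
apply/eqP; rewrite -subr_eq0 -normr_le0; apply/ler_addgt0Pl => e e0; rewrite addr0.
have e20 : 0 < e / 2 by rewrite divr_gt0.
have [d1 d10 H1] := continuous_rV_dist x c1 e20.
have [d2 d20 H2] := continuous_rV_dist x c2 e20.
pose h := Num.min d1 d2 / 2.
have h0 : 0 < h by rewrite divr_gt0// lt_min d10.
have hd : h < Num.min d1 d2 by rewrite /h ltr_pdivrMr// ltr_pMr ?lt_min ?d10// ltr1n.
have hd1 : h < d1 by move: hd; rewrite lt_min => /andP[].
have hd2 : h < d2 by move: hd; rewrite lt_min => /andP[].
have [a [b [ab1 ab2 E1]]] := second_difference x ij h0 cf.
have ji : j != i by rewrite eq_sym.
have [b' [a' [ab1' ab2' E2]]] := second_difference x ji h0 cf.
have N1 := H1 _ (upd2_near ab1 ab2 hd1 d10).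
have N2 := H2 _ (upd2_near ab1' ab2' hd2 d20).
have AB : partial j (partial i f) (upd (upd x i a) j b) =
          partial i (partial j f) (upd (upd x j b') i a').
  have hh : h * h != 0 by rewrite mulf_neq0// gt_eqF.
  apply: (mulfI hh).
  apply: (etrans (esym E1)).
  apply: (etrans _ E2).
  congr (_ + _).
  rewrite addrAC.
  congr (f _ - _ - _).
  exact: updC.
rewrite -AB in N2.
have tri (p q u : R) : `|p - u| < e / 2 -> `|q - u| < e / 2 -> `|p - q| <= e.
  move=> pu qu; apply: le_trans (ler_distD u p q) _.
  rewrite [leRHS]splitr; apply: lerD; first exact: ltW.
  by rewrite distrC; exact: ltW.
exact: (tri _ _ _ N1 N2).
Qed.

(** One coordinate of [x] after the other is replaced by that of [y]; each replacement moves along a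
    line on which [f] is constant. *)
Lemma partial0_const f : Ck 1 f -> (forall i x, partial i f x = 0) ->
  forall x y, f x = f y.
Proof.
move=> cf f0 x y.
have step z i t : f (upd z i t) = f z.
  rewrite -[in RHS](upd_id z i).
  apply: (@is_derive_0_is_cst _ (fun h => f (upd z i h))) => s.
  by rewrite -(f0 i (upd z i s)); exact: Ck_upd_derive cf.
have fold (s : seq 'I_n) : f (foldr (fun i z => upd z i (y 0 i)) x s) = f x.
  by elim: s => //= i s IH; rewrite step.
rewrite -(fold (enum 'I_n)); congr f; apply/rowP => k.
have: k \in enum 'I_n by rewrite mem_enum.
elim: (enum 'I_n) => //= i s IH; rewrite inE updE.
by case: eqP => [->//|_] /IH.
Qed.

End MeanValue.

(** * Iterated integrals over cubes *)

Section Segment.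
Variable R : realType.
Implicit Types (g h : R -> R) (a b c d r : R).
Local Notation mu := (@lebesgue_measure R).

Lemma integrable_segment a b g : continuous g -> mu.-integrable `[a, b] (EFin \o g).
Proof.
move=> cg; apply: continuous_compact_integrable; first exact: segment_compact.
exact: continuous_subspaceT.
Qed.

Lemma Rintegral_segment_le a b g h : continuous g -> continuous h ->
  (forall t, a <= t <= b -> g t <= h t) ->
  \int[mu]_(t in `[a, b]) g t <= \int[mu]_(t in `[a, b]) h t.
Proof.
move=> cg ch gh; apply: le_Rintegral => //.
- exact: integrable_segment.
- exact: integrable_segment.
Qed.

Lemma Rintegral_segment_cst a b c : a <= b ->
  \int[mu]_(t in `[a, b]) c = c * (b - a).
Proof.
move=> ab; rewrite Rintegral_cst//= lebesgue_measure_itv/= lte_fin.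
case: ltP => //= ba; have -> : b = a by apply/le_anti; rewrite ab ba.
by rewrite subrr.
Qed.

Lemma Rintegral_segment_subset a b c d g : continuous g -> c <= a -> b <= d ->
  (forall t, c <= t <= d -> 0 <= g t) ->
  \int[mu]_(t in `[a, b]) g t <= \int[mu]_(t in `[c, d]) g t.
Proof.
move=> cg ca bd g0; rewrite /Rintegral fine_le//.
- exact: integrable_fin_num (integrable_segment _ _ cg).
- exact: integrable_fin_num (integrable_segment _ _ cg).
apply: ge0_subset_integral => //.
- by have /integrableP[] := integrable_segment c d cg.
- move=> t /=; rewrite !in_itv/= => /andP[t1 t2].
  by rewrite (le_trans ca t1) (le_trans t2 bd).
Qed.

Lemma Rintegral_segment_gt0 a b g t0 : continuous g -> a < b ->
  (forall t, a <= t <= b -> 0 <= g t) -> a <= t0 <= b -> 0 < g t0 ->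
  0 < \int[mu]_(t in `[a, b]) g t.
Proof.
move=> cg ab g0 /andP[at0 t0b] gt0.
have g20 : 0 < g t0 / 2 by rewrite divr_gt0.
have /cvgrPdist_lt/(_ _ g20) := cg t0.
move=> /nbhs_ballP[d /= d0 H].
(* A neighbourhood of [t0] on which [g] exceeds [g t0 / 2], clipped to [[a, b]] since [t0] may be an
   endpoint. *)
pose c := Num.max a (t0 - d / 2); pose e := Num.min b (t0 + d / 2).
have ce : c < e.
  by rewrite lt_min !gt_max; do !(apply/andP; split); lra.
have ac : a <= c by rewrite le_max lexx.
have eb : e <= b by rewrite ge_min lexx.
apply: lt_le_trans (Rintegral_segment_subset cg ac eb g0).
have : 0 < g t0 / 2 * (e - c) by rewrite mulr_gt0// subr_gt0.
move=> /lt_le_trans; apply; rewrite -Rintegral_segment_cst; last exact: ltW.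
apply: Rintegral_segment_le => //; first exact: cst_continuous.
move=> t; rewrite ge_max le_min => /andP[/andP[_ t1] /andP[_ t2]].
have : ball t0 d t.
  by rewrite /ball /= ltr_norml; apply/andP; split; lra.
by move=> /H /=; rewrite ltr_norml => /andP[_]; lra.
Qed.

Lemma Rintegral_segment_FTC a b (G g : R -> R) : a < b -> continuous g ->
  (forall t : R, is_derive t 1 G (g t)) ->
  \int[mu]_(t in `[a, b]) g t = G b - G a.
Proof.
move=> ab cg dG; rewrite /Rintegral (@continuous_FTC2 R g G a b ab)//.
- exact: continuous_subspaceT.
- have cG : continuous G.
    by move=> t; apply/differentiable_continuous/derivable1_diffP; case: (dG t).
  split.
  + by move=> t _; case: (dG t).
  + exact: cvg_at_right_filter (cG a).
  + exact: cvg_at_left_filter (cG b).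
- by move=> t _; rewrite derive1E; case: (dG t).
Qed.

Lemma Rintegral_segment_dist a b g c : a <= b -> continuous g ->
  (forall t, a <= t <= b -> `|g t| <= c) ->
  `|\int[mu]_(t in `[a, b]) g t| <= c * (b - a).
Proof.
move=> ab cg gc; rewrite ler_norml -mulNr -!Rintegral_segment_cst//.
apply/andP; split; apply: Rintegral_segment_le => //; try exact: cst_continuous.
  by move=> t /gc; rewrite ler_norml => /andP[].
by move=> t /gc; rewrite ler_norml => /andP[].
Qed.

End Segment.

(** * Integration in one coordinate, and differentiation under the integral sign *)

Section SliceIntegral.
Variables (R : realType) (n : nat).
Implicit Types (f g : 'rV[R]_n -> R) (x y : 'rV[R]_n) (i j : 'I_n) (r e : R).
Local Notation mu := (@lebesgue_measure R).

(** The result is again a function on the whole space, constant in coordinate [i]: integrations can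
    be iterated and compared with [partial j] without a change of dimension. *)
Definition slint r i f : 'rV[R]_n -> R :=
  fun x => \int[mu]_(t in `[- r, r]) f (upd x i t).

Lemma upd_continuous f x i : continuous f -> continuous (fun t : R => f (upd x i t)).
Proof.
move=> cf t; apply/cvgrPdist_lt => e e0.
have [d d0 H] := continuous_rV_dist (upd x i t) cf e0.
near=> s; apply: H => k; rewrite !updE.
case: eqP => _; last by rewrite subrr normr0.
by near: s; apply/nbhs_ballP; exists d.
Unshelve. all: by end_near. Qed.

(** Compactness of the segment makes the modulus of continuity at [x] uniform in the integration
    variable. *)
Lemma slice_uniform f x i r e : continuous f -> 0 < e ->
  exists2 d : R, 0 < d & forall y : 'rV[R]_n, (forall k : 'I_n, `|x 0 k - y 0 k| < d) ->
    forall t, - r <= t <= r -> `|f (upd x i t) - f (upd y i t)| < e.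
Proof.
move=> cf e0; have e20 : 0 < e / 2 by rewrite divr_gt0.
have := (compact_near_coveringP `[- r, r]%classic).1 (@segment_compact R (- r) r).
move=> /(_ 'rV[R]_n (nbhs x) (fun y t => `|f (upd x i t) - f (upd y i t)| < e) (nbhs_filter x)) cover.
suff /cover/nbhs_ballP[d /= d0 H] : forall t, `[- r, r]%classic t ->
    \forall s \near t & y \near x, `|f (upd x i s) - f (upd y i s)| < e.
  exists d => // y xy t rt; apply: (H y) => /=; last by rewrite in_itv.
  by split => // a k; rewrite !ord1; exact: xy.
move=> t _.
have [d d0 H] := continuous_rV_dist (upd x i t) cf e20.
exists (ball t d, ball x d) => /=.
  by split; apply/nbhs_ballP; exists d.
move=> [s y] [/= st yx].
have h1 : `|f (upd x i t) - f (upd x i s)| < e / 2.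
  by apply: H => k; rewrite !updE; case: eqP => // _; rewrite subrr normr0.
have h2 : `|f (upd x i t) - f (upd y i s)| < e / 2.
  apply: H => k; rewrite !updE; case: eqP => // _.
  by case: yx => _ /(_ 0 k).
rewrite (le_lt_trans (ler_distD (f (upd x i t)) _ _))// [ltRHS]splitr.
by apply: ltrD => //; rewrite distrC.
Qed.

Lemma slint_continuous r i f : 0 < r -> continuous f -> continuous (slint r i f).
Proof.
move=> r0 cf x; apply/(@cvgrPdist_le _ _ _ _ (nbhs_filter x)) => e e0.
have rr : - r <= r by lra.
have e1 : 0 < e / (r + r) by rewrite divr_gt0// addr_gt0.
have [d d0 H] := slice_uniform x i r cf e1.
apply/nbhs_ballP; exists d => //= y [_ xy].
rewrite /slint -RintegralB//; try exact/integrable_segment/upd_continuous.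
have -> : e = e / (r + r) * (r - - r) by rewrite opprK divfK// gt_eqF// addr_gt0.
apply: Rintegral_segment_dist => //.
  move=> t; apply: (@continuousB _ _ _ (fun t => f (upd x i t)) (fun t => f (upd y i t))).
    exact: upd_continuous.
  exact: upd_continuous.
by move=> t rt; apply/ltW/H => // k; exact: xy.
Qed.

Lemma slint_upd r i f x t : slint r i f (upd x i t) = slint r i f x.
Proof. by rewrite /slint; under eq_Rintegral do rewrite upd_upd. Qed.

(** The increment of a difference quotient has either sign, hence this form without an order on [a]
    and [b]. *)
Lemma is_derive_mvt_abs (g dg : R -> R) (a b : R) :
  (forall t : R, is_derive t 1 g (dg t)) ->
  exists2 c, `|c - a| <= `|b - a| & g b - g a = dg c * (b - a).
Proof.
move=> dgE; have [ab|ba|->] := ltgtP a b.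
- have [c /andP[c1 c2] E] := is_derive_mvt ab dgE; exists c => //.
  by rewrite !ger0_norm; lra.
- have [c /andP[c1 c2] E] := is_derive_mvt ba dgE; exists c; last by lra.
  by rewrite !ler0_norm; lra.
- by exists b; rewrite // !subrr mulr0.
Qed.

(** By the mean value theorem the difference quotient of the integrand is [partial j f] at a point
    within [|h|] of the slice, and [slice_uniform] makes it close to [partial j f] on the slice,
    uniformly in [t]. *)
Lemma slint_derive r i j f x : 0 < r -> i != j -> Ck 1 f ->
  is_derive x (delta_mx 0 j) (slint r i f) (slint r i (partial j f) x).
Proof.
move=> r0 ij cf; have cf0 := Ck_continuous cf.
have cg : continuous (partial j f) := Ck_continuous (Ck_partial j cf).
have rr : - r <= r by lra.
rewrite -{1}(upd_id x j); apply/upd_derive.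
suff L : (fun h : R => h^-1 *: (((fun h : R => slint r i f (upd x j h)) \o shift (x 0 j)) (h *: 1) -
     slint r i f (upd x j (x 0 j)))) @ 0^' --> slint r i (partial j f) x.
  by split; [apply/cvg_ex; exists (slint r i (partial j f) x) | exact: cvg_lim L].
apply/cvgrPdist_le => e e0.
have e1 : 0 < e / (r + r) by rewrite divr_gt0// addr_gt0.
have [d d0 H] := slice_uniform x i r cg e1.
near=> h.
have h0 : h != 0 by near: h; exact: nbhs_dnbhs_neq.
have hd : `|h| < d.
  near: h; apply: dnbhs0_lt => //.
rewrite /= upd_id [h *: 1]mulr1 /slint.
set s := h + x 0 j.
have cx y : continuous (fun t : R => f (upd y i t)) by exact: upd_continuous.
have cgx y : continuous (fun t : R => partial j f (upd y i t)) by exact: upd_continuous.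
rewrite -RintegralB//; try exact: integrable_segment.
have cB : continuous (fun t : R => f (upd (upd x j s) i t) - f (upd x i t)).
  move=> t; exact: (@continuousB _ _ _ (fun t => f (upd (upd x j s) i t)) (fun t => f (upd x i t)) _ (cx _ _) (cx _ _)).
rewrite /GRing.scale/= -RintegralZl//; try exact: integrable_segment.
have cBZ : continuous (fun t : R => h^-1 * (f (upd (upd x j s) i t) - f (upd x i t))).
  move=> t; apply: (@continuousM _ _ (fun=> h^-1) (fun t => f (upd (upd x j s) i t) - f (upd x i t))).
    exact: cst_continuous.
  exact: cB.
rewrite -RintegralB//; try exact: integrable_segment.
have -> : e = e / (r + r) * (r - - r) by rewrite opprK divfK// gt_eqF// addr_gt0.
apply: Rintegral_segment_dist => //.
  by move=> t; exact: (@continuousB _ _ _ (fun t => partial j f (upd x i t)) (fun t => h^-1 * (f (upd (upd x j s) i t) - f (upd x i t))) _ (cgx _ _) (cBZ _)).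
move=> t rt.
have dF (u : R) : is_derive u 1 (fun u => f (upd (upd x i t) j u)) (partial j f (upd (upd x i t) j u)).
  exact: Ck_upd_derive cf.
have [c c1] := is_derive_mvt_abs (x 0 j) s dF.
have xj : upd x i t 0 j = x 0 j by rewrite updE eq_sym (negbTE ij).
have -> : upd (upd x i t) j (x 0 j) = upd x i t by rewrite -[in X in upd _ _ X]xj upd_id.
rewrite !(updC x _ _ ij) => ->.
have sh : s - x 0 j = h by rewrite /s addrK.
rewrite sh mulrCA mulVf// mulr1; apply/ltW/H => // k.
rewrite updE; case: eqP => [->|_]; last by rewrite subrr normr0.
by rewrite distrC (le_lt_trans c1)// sh.
Unshelve. all: by end_near. Qed.

Lemma slint_Ck1 r i f : 0 < r -> Ck 1 f -> Ck 1 (slint r i f).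
Proof.
move=> r0 cf.
apply: (@CkI _ _ 0 _ (fun j => if j == i then fun=> 0 else slint r i (partial j f))).
- exact: slint_continuous (Ck_continuous cf).
- move=> j x; have [->|ji] := eqVneq j i.
    rewrite -{1}(upd_id x i); apply/upd_derive.
    by under eq_fun do rewrite slint_upd; exact: is_derive_cst.
  by apply: slint_derive => //; rewrite eq_sym.
- move=> j; case: eqP => _; first exact: (@Ck_cst _ _ 0 0).
  by split => //; apply: slint_continuous => //; exact: Ck_continuous (Ck_partial j cf).
Qed.

Lemma slint_partial r i j f : 0 < r -> i != j -> Ck 1 f ->
  slint r i (partial j f) = partial j (slint r i f).
Proof.
by move=> r0 ij cf; apply/funext => x; apply/esym/partial_val; exact: slint_derive.
Qed.

Lemma slint_partial_same r i f x : 0 < r -> Ck 1 f ->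
  slint r i (partial i f) x = f (upd x i r) - f (upd x i (- r)).
Proof.
move=> r0 cf; apply: (@Rintegral_segment_FTC _ _ _ (fun t => f (upd x i t))).
- by lra.
- apply: upd_continuous; exact: Ck_continuous (Ck_partial i cf).
- by move=> t; exact: Ck_upd_derive cf.
Qed.

End SliceIntegral.

(** * Integrals over cubes and their boundary terms *)

Section CubeIntegral.
Variables (R : realType) (n : nat).
Implicit Types (f g : 'rV[R]_n -> R) (x y : 'rV[R]_n) (i j : 'I_n) (r e c : R)
  (s : seq 'I_n).

Definition in_cube r x := forall k : 'I_n, - r <= x 0 k <= r.

Lemma in_cube_upd r x i t : in_cube r x -> - r <= t <= r -> in_cube r (upd x i t).
Proof. by move=> xr tr k; rewrite updE; case: eqP. Qed.

(** For [s = enum 'I_n] this is the integral over the cube, constant in the base point. For shorter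
    lists the other coordinates stay frozen; inductions pass through these, whence the hypothesis
    [in_cube r x] in the comparison lemmas. *)
Definition cubeint r s f := foldr (slint r) f s.

Lemma cubeint_continuous r s f : 0 < r -> continuous f -> continuous (cubeint r s f).
Proof. by move=> r0 cf; elim: s => //= i s; exact: slint_continuous. Qed.

Lemma slintD r i f g : continuous f -> continuous g ->
  slint r i (fun x => f x + g x) = fun x => slint r i f x + slint r i g x.
Proof.
by move=> cf cg; apply/funext => x; rewrite /slint RintegralD//;
  exact/integrable_segment/upd_continuous.
Qed.

Lemma slintZ r i c f : continuous f ->
  slint r i (fun x => c * f x) = fun x => c * slint r i f x.
Proof.
by move=> cf; apply/funext => x; rewrite /slint RintegralZl//;
  exact/integrable_segment/upd_continuous.
Qed.

Lemma cubeintD r s f g : 0 < r -> continuous f -> continuous g ->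
  cubeint r s (fun x => f x + g x) = fun x => cubeint r s f x + cubeint r s g x.
Proof.
move=> r0 cf cg; elim: s => //= i s ->.
by apply: slintD; exact: cubeint_continuous.
Qed.

Lemma cubeintZ r s c f : 0 < r -> continuous f ->
  cubeint r s (fun x => c * f x) = fun x => c * cubeint r s f x.
Proof.
move=> r0 cf; elim: s => //= i s ->.
by apply: slintZ; exact: cubeint_continuous.
Qed.

Lemma cubeint_cst r s c : 0 < r ->
  cubeint r s (fun=> c) = fun=> c * (2 * r) ^+ size s.
Proof.
move=> r0; elim: s => /= [|i s ->]; first by apply/funext => x; rewrite mulr1.
apply/funext => x; rewrite /slint Rintegral_segment_cst; last by lra.
by rewrite exprSr mulrA; congr (_ * _); ring.
Qed.

Lemma cubeint_le r s f g : 0 < r -> continuous f -> continuous g ->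
  (forall x, in_cube r x -> f x <= g x) ->
  forall x, in_cube r x -> cubeint r s f x <= cubeint r s g x.
Proof.
move=> r0 cf cg fg; elim: s => //= i s IH x xr.
apply: Rintegral_segment_le.
- exact/upd_continuous/cubeint_continuous.
- exact/upd_continuous/cubeint_continuous.
- by move=> t tr; apply/IH/in_cube_upd.
Qed.

Lemma cubeint_ge0 r s f : 0 < r -> continuous f ->
  (forall x, in_cube r x -> 0 <= f x) ->
  forall x, in_cube r x -> 0 <= cubeint r s f x.
Proof.
move=> r0 cf f0 x xr.
have := @cubeint_le r s (fun=> 0) f r0 _ cf f0 x xr.
by rewrite cubeint_cst// mul0r; apply; exact: cst_continuous.
Qed.

Lemma cubeint_gt0 r s f x : 0 < r -> continuous f ->
  (forall y, in_cube r y -> 0 <= f y) -> in_cube r x -> 0 < f x ->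
  0 < cubeint r s f x.
Proof.
move=> r0 cf f0 xr fx; elim: s => //= i s IH.
apply: (@Rintegral_segment_gt0 _ _ _ _ (x 0 i)).
- exact/upd_continuous/cubeint_continuous.
- by lra.
- by move=> t tr; apply: cubeint_ge0 => //; exact: in_cube_upd.
- exact: xr.
- by rewrite upd_id.
Qed.

Lemma cubeint_widen r r' s f : 0 < r -> r <= r' -> continuous f ->
  (forall x, in_cube r' x -> 0 <= f x) ->
  forall x, in_cube r x -> cubeint r s f x <= cubeint r' s f x.
Proof.
move=> r0 rr' cf f0; have r'0 := lt_le_trans r0 rr'.
have wide t : - r <= t <= r -> - r' <= t <= r' by move=> /andP[]; lra.
elim: s => [|i s IH] x xr; first exact: lexx.
apply: (@le_trans _ _ (slint r i (cubeint r' s f) x)).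
  apply: Rintegral_segment_le.
  - exact/upd_continuous/cubeint_continuous.
  - exact/upd_continuous/cubeint_continuous.
  - by move=> t tr; apply/IH/in_cube_upd.
apply: Rintegral_segment_subset => //.
- exact/upd_continuous/cubeint_continuous.
- by rewrite lerN2.
- move=> t tr; apply: cubeint_ge0 => //; apply: in_cube_upd => // k.
  exact: wide.
Qed.

Lemma cubeint_partial r s i f : 0 < r -> Ck 1 f -> i \notin s ->
  cubeint r s (partial i f) = partial i (cubeint r s f) /\ Ck 1 (cubeint r s f).
Proof.
move=> r0 cf; elim: s => //= j s IH; rewrite inE negb_or => /andP[ij /IH[-> H]].
by split; [apply: slint_partial => //; rewrite eq_sym|exact: slint_Ck1].
Qed.

Lemma cubeint_face r s i f : i \notin s ->
  (forall y, `|y 0 i| = r -> f y = 0) ->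
  forall y, `|y 0 i| = r -> cubeint r s f y = 0.
Proof.
move=> + f0; elim: s => //= j s IH; rewrite inE negb_or => /andP[ij /IH{}IH] y yr.
rewrite /slint; under eq_Rintegral => t _.
  rewrite IH; last by rewrite updE (negbTE ij).
  over.
by rewrite Rintegral_cst//= mul0r.
Qed.

(** The derivative commutes with the integrations inside the one in coordinate [i]; that one leaves
    a difference of values on two opposite faces, where [f] and hence its inner integrals vanish. *)
Lemma cubeint_partial0 r s i f : 0 < r -> Ck 1 f -> uniq s -> i \in s ->
  (forall y, `|y 0 i| = r -> f y = 0) -> cubeint r s (partial i f) = fun=> 0.
Proof.
move=> r0 cf us is_ f0.
elim: s us is_ => //= j s IH /andP[js us]; rewrite inE => /predU1P[ij|/(IH us) ->].
  subst j; have [-> cI] := cubeint_partial r0 cf js.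
  apply/funext => x; rewrite slint_partial_same//.
  rewrite !(cubeint_face js f0) ?subrr// updE eqxx ?normrN; apply/ger0_norm/ltW => //.
by apply/funext => x; rewrite /slint Rintegral_cst//= mul0r.
Qed.

End CubeIntegral.

(** * Pointwise inequalities *)

Section PointwiseAlgebra.
Variable R : realType.

(** Lagrange's identity: the difference of the two sides is the sum of the squared 2 x 2 minors. *)
Lemma cauchy_schwarz4 (a0 a1 a2 a3 b0 b1 b2 b3 : R) :
  (a0 * b0 + a1 * b1 + a2 * b2 + a3 * b3) ^+ 2 <=
  (a0 ^+ 2 + a1 ^+ 2 + a2 ^+ 2 + a3 ^+ 2) * (b0 ^+ 2 + b1 ^+ 2 + b2 ^+ 2 + b3 ^+ 2).
Proof.
rewrite -subr_ge0.
have -> : (a0 ^+ 2 + a1 ^+ 2 + a2 ^+ 2 + a3 ^+ 2) * (b0 ^+ 2 + b1 ^+ 2 + b2 ^+ 2 + b3 ^+ 2)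
  - (a0 * b0 + a1 * b1 + a2 * b2 + a3 * b3) ^+ 2 =
  (a0 * b1 - a1 * b0) ^+ 2 + (a0 * b2 - a2 * b0) ^+ 2 + (a0 * b3 - a3 * b0) ^+ 2 +
  (a1 * b2 - a2 * b1) ^+ 2 + (a1 * b3 - a3 * b1) ^+ 2 + (a2 * b3 - a3 * b2) ^+ 2 by ring.
by rewrite !addr_ge0// sqr_ge0.
Qed.

(* With z = E g, Cauchy-Schwarz against the traceless symmetric part
   S = (z g^T + g z^T)/2 - (z.g)/4 of z g^T, for which <E, S> = |z|^2 and
   |S|^2 <= 3/4 |z|^2 |g|^2. *)
Lemma traceless_cauchy_schwarz4
  (e00 e01 e02 e03 e11 e12 e13 e22 e23 e33 g0 g1 g2 g3 : R) :
  e00 + e11 + e22 + e33 = 0 ->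
  4 * ((e00 * g0 + e01 * g1 + e02 * g2 + e03 * g3) ^+ 2 +
       (e01 * g0 + e11 * g1 + e12 * g2 + e13 * g3) ^+ 2 +
       (e02 * g0 + e12 * g1 + e22 * g2 + e23 * g3) ^+ 2 +
       (e03 * g0 + e13 * g1 + e23 * g2 + e33 * g3) ^+ 2) <=
  3 * (e00 ^+ 2 + e11 ^+ 2 + e22 ^+ 2 + e33 ^+ 2 + 2 * (e01 ^+ 2 + e02 ^+ 2 +
        e03 ^+ 2 + e12 ^+ 2 + e13 ^+ 2 + e23 ^+ 2))
    * (g0 ^+ 2 + g1 ^+ 2 + g2 ^+ 2 + g3 ^+ 2).
Proof.
move=> tr0.
set z0 := e00 * g0 + _ + _ + _; set z1 := e01 * g0 + _ + _ + _.
set z2 := e02 * g0 + _ + _ + _; set z3 := e03 * g0 + _ + _ + _.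
set A := e00 ^+ 2 + _ + _ + _ + _; set N := g0 ^+ 2 + _ + _ + _.
set Z := z0 ^+ 2 + _ + _ + _; pose s := z0 * g0 + z1 * g1 + z2 * g2 + z3 * g3.
have s2 : s ^+ 2 <= Z * N by exact: cauchy_schwarz4.
have N0 : 0 <= N by rewrite !addr_ge0// sqr_ge0.
have Z0 : 0 <= Z by rewrite !addr_ge0// sqr_ge0.
have key t : 0 <= A - 2 * t * Z + t ^+ 2 * (Z * N / 2 + s ^+ 2 / 4).
  have EZ : Z = (z0 * z0 + z1 * z1 + z2 * z2 + z3 * z3)
      - (e00 + e11 + e22 + e33) * s / 4 by rewrite tr0 /Z; ring.
  rewrite [in 2 * t * Z]EZ.
  have -> : A - 2 * t * (z0 * z0 + z1 * z1 + z2 * z2 + z3 * z3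
      - (e00 + e11 + e22 + e33) * s / 4) + t ^+ 2 * (Z * N / 2 + s ^+ 2 / 4) =
    (e00 - t * (z0 * g0 - s / 4)) ^+ 2 + (e11 - t * (z1 * g1 - s / 4)) ^+ 2 +
    (e22 - t * (z2 * g2 - s / 4)) ^+ 2 + (e33 - t * (z3 * g3 - s / 4)) ^+ 2 +
    2 * ((e01 - t * ((z0 * g1 + z1 * g0) / 2)) ^+ 2 +
         (e02 - t * ((z0 * g2 + z2 * g0) / 2)) ^+ 2 +
         (e03 - t * ((z0 * g3 + z3 * g0) / 2)) ^+ 2 +
         (e12 - t * ((z1 * g2 + z2 * g1) / 2)) ^+ 2 +
         (e13 - t * ((z1 * g3 + z3 * g1) / 2)) ^+ 2 +
         (e23 - t * ((z2 * g3 + z3 * g2) / 2)) ^+ 2).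
    by rewrite /A /Z /N /s /z0 /z1 /z2 /z3; field.
  by rewrite !addr_ge0// ?sqr_ge0// mulr_ge0// !addr_ge0// sqr_ge0.
have [N00|Npos] := eqVneq N 0.
  have g_0 (u : R) : u ^+ 2 <= N -> u = 0.
    by rewrite N00 => u0; apply/eqP; rewrite -sqrf_eq0 eq_le u0 sqr_ge0.
  have [p0 p1 p2 p3] := And4 (sqr_ge0 g0) (sqr_ge0 g1) (sqr_ge0 g2) (sqr_ge0 g3).
  have [i0 i1 i2 i3] : [/\ g0 = 0, g1 = 0, g2 = 0 & g3 = 0].
    by split; apply: g_0; rewrite /N; lra.
  by rewrite /Z /z0 /z1 /z2 /z3 /N i0 i1 i2 i3 !mulr0 !addr0 expr0n/= !addr0 !mulr0.
have {}Npos : 0 < N by rewrite lt_neqAle eq_sym Npos.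
(* [key] is |E - t S|^2 >= 0; once s^2 is bounded by Z N, the value t = 4 / (3 N) minimises A - 2 t
   Z + 3/4 t^2 Z N. *)
have {}key : 0 <= A - 2 * (4 / (3 * N)) * Z + (4 / (3 * N)) ^+ 2 * (Z * N / 2 + Z * N / 4).
  apply: le_trans (key (4 / (3 * N))) _.
  by rewrite lerD2l ler_wpM2l ?sqr_ge0// lerD2l ler_wpM2r// invr_ge0.
have E : A - 2 * (4 / (3 * N)) * Z + (4 / (3 * N)) ^+ 2 * (Z * N / 2 + Z * N / 4)
   = (3 * A * N - 4 * Z) / (3 * N) by field; rewrite gt_eqF.
by move: key; rewrite E pmulr_lge0 ?invr_gt0 ?mulr_gt0// subr_ge0.
Qed.

Definition o0 : 'I_4 := @Ordinal 4 0 isT.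
Definition o1 : 'I_4 := @Ordinal 4 1 isT.
Definition o2 : 'I_4 := @Ordinal 4 2 isT.
Definition o3 : 'I_4 := @Ordinal 4 3 isT.

Lemma sum4E (F : 'I_4 -> R) : \sum_(i < 4) F i = F o0 + F o1 + F o2 + F o3.
Proof.
rewrite !big_ord_recl big_ord0 addr0 !addrA.
by congr (_ + _ + _ + _); congr F; apply/val_inj.
Qed.

(** At one point, [g] and [p] are the gradients of w and P, [H] is the Hessian of w and [L] the
    Laplacian of P; then w L - 2 g.p = w^3 div (w^-2 grad P). With E = H - P/4 Id this equals 4
    |E|^2, and w p = 4 E g. Hence w^2 |p|^2 = 16 |E g|^2 <= 12 |E|^2 |g|^2 <= 6 |E|^2 w P, the last
    step because 2 |g|^2 = w P - 2. *)
Lemma hessian_gradient_bound (w P L : R) (g p : 'I_4 -> R) (H : 'I_4 -> 'I_4 -> R) :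
  0 < w -> (forall k i, H k i = H i k) -> P = \sum_k H k k ->
  w * P = 2 * \sum_k g k ^+ 2 + 2 ->
  (forall k, g k * P + w * p k = 4 * \sum_i g i * H k i) ->
  w * L - 2 * \sum_k g k * p k = 4 * \sum_k \sum_i H k i ^+ 2 - P ^+ 2 ->
  2 * w * \sum_k p k ^+ 2 <= 3 * P * (w * L - 2 * \sum_k g k * p k).
Proof.
move=> w0 Hsym trP wP dP dL; rewrite dL; move: trP wP dP; clear dL L.
rewrite !sum4E => trP wP dP.
rewrite (Hsym o1 o0) (Hsym o2 o0) (Hsym o2 o1) (Hsym o3 o0) (Hsym o3 o1) (Hsym o3 o2).
have := (dP o0, dP o1, dP o2, dP o3); rewrite !sum4E.
rewrite (Hsym o1 o0) (Hsym o2 o0) (Hsym o2 o1) (Hsym o3 o0) (Hsym o3 o1) (Hsym o3 o2).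
clear dP Hsym; move: trP wP.
move: (H o0 o0) (H o0 o1) (H o0 o2) (H o0 o3) (H o1 o1) (H o1 o2) (H o1 o3)
  (H o2 o2) (H o2 o3) (H o3 o3) (g o0) (g o1) (g o2) (g o3) (p o0) (p o1) (p o2) (p o3).
move=> h00 h01 h02 h03 h11 h12 h13 h22 h23 h33 g0 g1 g2 g3 p0 p1 p2 p3.
move=> trP wP [[[E0 E1] E2] E3].
have tr0 : (h00 - P / 4) + (h11 - P / 4) + (h22 - P / 4) + (h33 - P / 4) = 0.
  by rewrite trP; field.
have := traceless_cauchy_schwarz4 h01 h02 h03 h12 h13 h23 g0 g1 g2 g3 tr0.
set A := (h00 - _) ^+ 2 + _ + _ + _ + _; set N := g0 ^+ 2 + _ + _ + _.
set q0 := _ + h03 * g3; set q1 := _ + h13 * g3; set q2 := _ + h23 * g3.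
set q3 := _ + (h33 - _) * g3 => cs.
have A0 : 0 <= A by rewrite !addr_ge0// ?sqr_ge0// mulr_ge0// !addr_ge0// sqr_ge0.
have N0 : 0 <= N by rewrite !addr_ge0// sqr_ge0.
have wp0 : w * p0 = 4 * q0 by apply: (addrI (g0 * P)); rewrite E0 /q0; field.
have wp1 : w * p1 = 4 * q1 by apply: (addrI (g1 * P)); rewrite E1 /q1; field.
have wp2 : w * p2 = 4 * q2 by apply: (addrI (g2 * P)); rewrite E2 /q2; field.
have wp3 : w * p3 = 4 * q3 by apply: (addrI (g3 * P)); rewrite E3 /q3; field.
set p2s := p0 ^+ 2 + _ + _ + _; set D := 4 * _ - P ^+ 2.
have -> : D = 4 * A by rewrite /D /A trP; field.
have wpp : w ^+ 2 * p2s = 16 * (q0 ^+ 2 + q1 ^+ 2 + q2 ^+ 2 + q3 ^+ 2).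
  by rewrite /p2s !mulrDr -!exprMn wp0 wp1 wp2 wp3; ring.
rewrite -/N in wP.
have wP0 : 0 < w * P by rewrite wP; lra.
have P0 : 0 < P by rewrite pmulr_rgt0 in wP0.
have AN : 2 * (A * N) <= A * (w * P).
  by rewrite wP; lra.
have H1 : w * (w * p2s) <= w * (6 * A * P) by lra.
have {}H1 : w * p2s <= 6 * A * P by rewrite -(ler_pM2l w0).
by lra.
Qed.

(** Inserting P = S^2 in [hessian_gradient_bound] and dividing by P leaves 8 w |s|^2 on the left;
    the term 2 |s|^2 of the Laplacian of S^2 takes 6 w |s|^2 of it away, and a positive rest of 2 w
    |s|^2 survives. *)
Lemma sqrt_gradient_bound (w P S : R) (g p q s t : 'I_4 -> R) (H : 'I_4 -> 'I_4 -> R) :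
  0 < w -> 0 < S -> P = S * S -> (forall k i, H k i = H i k) -> P = \sum_k H k k ->
  w * P = 2 * \sum_k g k ^+ 2 + 2 ->
  (forall k, g k * P + w * p k = 4 * \sum_i g i * H k i) ->
  (forall k, p k = 2 * (S * s k)) -> (forall k, q k = 2 * (s k ^+ 2 + S * t k)) ->
  w * (\sum_k q k) - 2 * \sum_k g k * p k = 4 * \sum_k \sum_i H k i ^+ 2 - P ^+ 2 ->
  w * \sum_k s k ^+ 2 <= 3 * S * (w * \sum_k t k - 2 * \sum_k g k * s k).
Proof.
move=> w0 S0 PE Hs trP wP dP pE qE dL.
have := hessian_gradient_bound w0 Hs trP wP dP dL.
have -> : \sum_k p k ^+ 2 = 4 * P * \sum_k s k ^+ 2.
  by rewrite mulr_sumr; apply: eq_bigr => k _; rewrite pE PE; ring.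
have -> : \sum_k q k = 2 * (\sum_k s k ^+ 2 + S * \sum_k t k).
  by rewrite [S * _]mulr_sumr -big_split mulr_sumr /=; apply: eq_bigr => k _.
have -> : \sum_k g k * p k = 2 * S * \sum_k g k * s k.
  by rewrite mulr_sumr; apply: eq_bigr => k _; rewrite pE; ring.
have P0 : 0 < P by rewrite PE mulr_gt0.
move: (\sum_k _ ^+ 2) (\sum_k t k) (\sum_k g k * _) => a b c h.
have : P * (8 * (w * a)) <= P * (6 * (w * a) + 6 * S * (w * b - 2 * c)) by lra.
by rewrite ler_pM2l//; lra.
Qed.

(** The traceless part has norm zero, since |H - P/4 Id|^2 = |H|^2 - P^2/4. *)
Lemma hessian_rigid (P : R) (H : 'I_4 -> 'I_4 -> R) :
  P = \sum_k H k k -> 4 * \sum_k \sum_i H k i ^+ 2 = P ^+ 2 ->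
  forall k i, H k i = P / 4 * (k == i)%:R.
Proof.
move=> trP HP.
have : \sum_k \sum_i (H k i - P / 4 * (k == i)%:R) ^+ 2 = 0.
  transitivity (\sum_k \sum_i H k i ^+ 2 - P / 2 * \sum_k H k k + P ^+ 2 / 4).
    by rewrite !sum4E /=; field.
  by rewrite -trP; lra.
move/eqP; rewrite psumr_eq0 => [/allP/= Hk k i|k _]; last first.
  by apply: sumr_ge0 => i _; exact: sqr_ge0.
have := Hk k (mem_index_enum _).
rewrite psumr_eq0 => [/allP/= Hi|j _]; last exact: sqr_ge0.
have := Hi i (mem_index_enum _).
by rewrite sqrf_eq0 subr_eq0 => /eqP.
Qed.

(** The summation step of a Bochner formula: [T k i] stands for the third derivative in k, k, i, and
    exchanging the sums turns the third-order terms into g.p. *)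
Lemma bochner_sum n (h g p h2 q : 'I_n -> R) (T : 'I_n -> 'I_n -> R) (W L : R) :
  (forall k, h k * L + 2 * (g k * p k) + W * q k = 4 * (h2 k + \sum_i g i * T k i)) ->
  \sum_k h k = L -> (forall i, \sum_k T k i = p i) ->
  W * \sum_k q k - 2 * \sum_k g k * p k = 4 * \sum_k h2 k - L ^+ 2.
Proof.
move=> e hL Tp; have := @eq_bigr _ 0 +%R _ (index_enum 'I_n) xpredT _ _ (fun k _ => e k).
rewrite !big_split /= -mulr_suml hL -!mulr_sumr big_split /= exchange_big /=.
under [X in _ = 4 * (_ + X)]eq_bigr do rewrite -mulr_sumr Tp.
lra.
Qed.

(** Since y^3 - 27 y a^2 + 54 a^3 = (y - 3 a)^2 (y + 6 a), even 27 would do; 24 is the coefficient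
    of the error term in [cube_v3], where y = psi v and a = 1/r. *)
Lemma cubic_young (y a : R) : 0 <= y -> 0 <= a -> 24 * y * a ^+ 2 <= y ^+ 3 + 54 * a ^+ 3.
Proof.
move=> y0 a0; have := mulr_ge0 (sqr_ge0 (y - 3 * a)) (addr_ge0 y0 (mulr_ge0 (ler0n R 6) a0)).
have := mulr_ge0 y0 (sqr_ge0 a).
have -> : (y - 3 * a) ^+ 2 * (y + 6 * a) = y ^+ 3 - 27 * (y * a ^+ 2) + 54 * a ^+ 3 by ring.
lra.
Qed.

(** Here c = psi, s = S, u = v, t = 1/r; a and b are |grad psi|^2 and |grad S|^2, g = grad psi .
    grad S, p = grad w . grad S, and q is the Laplacian of S. The factor 6 uses the inequality for S
    twice, which gains 2 A with A = c^5 u^2 b / s: one A is the left side, the other completes the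
    square against the cross term 30 c^4 u^2 g. What remains is 225 c^3 u^2 s a <= 3600 t^2 c^3 u^2
    s, split by Young's inequality with weight [l]. *)
Lemma gradS_pointwise (l a b g q p c s u t : R) : 0 < l ->
  0 <= c -> c <= 1 -> 0 < s -> 0 < u -> 0 < t ->
  0 <= c ^+ 2 * b + 30 * (c * s) * g + 225 * s ^+ 2 * a ->
  u^-1 * b <= 3 * s * (u^-1 * q - 2 * p) -> a <= 16 * t ^+ 2 ->
  c ^+ 5 * (u ^+ 2 * b * s^-1) + (- 30 * c ^+ 4 * u ^+ 2 * g + 12 * c ^+ 5 * u ^+ 3 * p
    - 6 * c ^+ 5 * u ^+ 2 * q) <=
  1800 * t ^+ 2 * (l * (c ^+ 2 * (u * (s * s))) + l^-1 * (c ^+ 3 * u ^+ 3)).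
Proof.
move=> l0 c0 c1 s0 u0 t0 h1 h2 h3.
have un0 : u != 0 by rewrite gt_eqF.
have sn0 : s != 0 by rewrite gt_eqF.
have ln0 : l != 0 by rewrite gt_eqF.
have c5 : 0 <= c ^+ 5 * u ^+ 3 / s.
  by rewrite divr_ge0 ?mulr_ge0 ?exprn_ge0// ltW.
have {}h2 := ler_wpM2l c5 h2.
have c3 : 0 <= c ^+ 3 * u ^+ 2 / s.
  by rewrite divr_ge0 ?mulr_ge0 ?exprn_ge0// ltW.
have {}h1 := mulr_ge0 c3 h1.
have c3' : 0 <= 225 * c ^+ 3 * u ^+ 2 * s.
  apply: mulr_ge0; last exact: ltW.
  apply: mulr_ge0; last exact: sqr_ge0.
  by apply: mulr_ge0; [exact: ler0n|exact: exprn_ge0].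
have {}h3 := ler_wpM2l c3' h3.
have E2 : c ^+ 5 * u ^+ 3 / s * (u^-1 * b) = c ^+ 5 * u ^+ 2 * b / s
  by field; rewrite un0 sn0.
have E2' : c ^+ 5 * u ^+ 3 / s * (3 * s * (u^-1 * q - 2 * p)) =
  3 * c ^+ 5 * u ^+ 2 * q - 6 * c ^+ 5 * u ^+ 3 * p
  by field; rewrite un0 sn0.
have E1 : c ^+ 3 * u ^+ 2 / s * (c ^+ 2 * b + 30 * (c * s) * g + 225 * s ^+ 2 * a) =
  c ^+ 5 * u ^+ 2 * b / s + 30 * c ^+ 4 * u ^+ 2 * g + 225 * c ^+ 3 * u ^+ 2 * s * a by field.
rewrite E2 E2' in h2; rewrite E1 in h1.
have E0 : c ^+ 5 * (u ^+ 2 * b * s^-1) = c ^+ 5 * u ^+ 2 * b / s by ring.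
rewrite E0.
have young : 2 * (c ^+ 3 * u ^+ 2 * s) <=
    l * (c ^+ 2 * (u * (s * s))) + l^-1 * (c ^+ 3 * u ^+ 3).
  have cle : c ^+ 3 * (u * (l * (s * s))) <= c ^+ 2 * (u * (l * (s * s))).
    apply: ler_wpM2r; last exact: ler_wiXn2l.
    by apply: mulr_ge0; [exact: ltW|apply: mulr_ge0; [exact: ltW|apply: mulr_ge0; exact: ltW]].
  have : 0 <= c ^+ 3 * u * l^-1 * (l * s - u) ^+ 2.
    apply: mulr_ge0; last exact: sqr_ge0.
    apply: mulr_ge0; last by rewrite invr_ge0 ltW.
    by apply: mulr_ge0; [exact: exprn_ge0|exact: ltW].
  have -> : c ^+ 3 * u * l^-1 * (l * s - u) ^+ 2 =
    c ^+ 3 * (u * (l * (s * s))) - 2 * (c ^+ 3 * u ^+ 2 * s) + l^-1 * (c ^+ 3 * u ^+ 3) by field.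
  lra.
have t2 : 0 <= 1800 * t ^+ 2 by apply: mulr_ge0; [exact: ler0n|exact: sqr_ge0].
have {}young := ler_wpM2l t2 young.
have lin (A B C D F G Y : R) : 0 <= A + 30 * B + 225 * C -> A <= 3 * D - 6 * F ->
    225 * C <= 3600 * G -> 3600 * G <= Y -> A + (- 30 * B + 12 * F - 6 * D) <= Y.
  by clear; lra.
have -> : - 30 * c ^+ 4 * u ^+ 2 * g + 12 * c ^+ 5 * u ^+ 3 * p - 6 * c ^+ 5 * u ^+ 2 * q =
  - 30 * (c ^+ 4 * u ^+ 2 * g) + 12 * (c ^+ 5 * u ^+ 3 * p) - 6 * (c ^+ 5 * u ^+ 2 * q) by ring.
apply: (lin _ _ (c ^+ 3 * u ^+ 2 * s * a) _ _ (t ^+ 2 * (c ^+ 3 * u ^+ 2 * s))).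
- by rewrite !mulrA; rewrite !mulrA in h1.
- by rewrite !mulrA; rewrite !mulrA in h2.
- suff -> : 3600 * (t ^+ 2 * (c ^+ 3 * u ^+ 2 * s)) = 225 * c ^+ 3 * u ^+ 2 * s * (16 * t ^+ 2).
    by rewrite !mulrA; rewrite !mulrA in h3.
  ring.
- suff -> : 3600 * (t ^+ 2 * (c ^+ 3 * u ^+ 2 * s)) = 1800 * t ^+ 2 * (2 * (c ^+ 3 * u ^+ 2 * s)).
    exact: young.
  ring.
Qed.

End PointwiseAlgebra.

(** * Cutoff functions *)

Section Cutoff.
Variables (R : realType) (n : nat).
Implicit Types (x y : 'rV[R]_n) (i j k : 'I_n) (r : R).

Definition cutoff r x : R := \prod_(i < n) (1 - (x 0 i / r) ^+ 2).

(** Constant in coordinate [k], so that derivatives of [cutoff] in that direction only see a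
    quadratic factor. *)
Definition cutoff_omit r k x : R := \prod_(i < n | i != k) (1 - (x 0 i / r) ^+ 2).

Lemma cutoffE r k x : cutoff r x = (1 - (x 0 k / r) ^+ 2) * cutoff_omit r k x.
Proof. by rewrite /cutoff (bigD1 k). Qed.

Lemma cutoff_factor_Ck m r k : Ck m (fun x : 'rV[R]_n => 1 - (x 0 k / r) ^+ 2).
Proof.
apply: Ck_add; first exact: Ck_cst.
by apply/Ck_opp/Ck_exp/Ck_mul; [exact: Ck_coord|exact: Ck_cst].
Qed.

Lemma cutoff_Ck m r : Ck m (cutoff r).
Proof. by apply: Ck_prod => i; exact: cutoff_factor_Ck. Qed.

Lemma cutoff_omit_upd r k x t : cutoff_omit r k (upd x k t) = cutoff_omit r k x.
Proof. by apply: eq_bigr => i ik; rewrite updE (negbTE ik). Qed.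

Lemma cutoff_omit_derive r k x : is_derive x (delta_mx 0 k) (cutoff_omit r k) 0.
Proof.
rewrite -{1}(upd_id x k); apply/upd_derive.
by under eq_fun do rewrite cutoff_omit_upd; exact: is_derive_cst.
Qed.

Lemma coord_derive k x : is_derive x (delta_mx 0 k) (fun y : 'rV[R]_n => y 0 k) 1.
Proof. by have := is_derive_coord x k k; rewrite eqxx. Qed.

Lemma cutoff_derive r k x :
  is_derive x (delta_mx 0 k) (cutoff r) (- 2 * (x 0 k / r ^+ 2) * cutoff_omit r k x).
Proof.
have -> : cutoff r = fun y => (1 + - r ^- 2 * (y 0 k * y 0 k)) * cutoff_omit r k y.
  apply/funext => y; rewrite (cutoffE r k) exprMn exprVn.
  by congr (_ * _); congr (_ + _); rewrite mulNr expr2 mulrC.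
have d := is_derive_mul (is_derive_add (is_derive_const 1 x (delta_mx 0 k))
  (is_derive_mul (is_derive_const (- r ^- 2) x (delta_mx 0 k))
    (is_derive_mul (coord_derive k x) (coord_derive k x)))) (cutoff_omit_derive r k x).
by apply: (is_derive_eq d); rewrite /=; ring.
Qed.

Lemma cutoff_partial r k x :
  partial k (cutoff r) x = - 2 * (x 0 k / r ^+ 2) * cutoff_omit r k x.
Proof. exact/partial_val/cutoff_derive. Qed.

Lemma cutoff_partial2 r k x :
  partial k (partial k (cutoff r)) x = - 2 / r ^+ 2 * cutoff_omit r k x.
Proof.
have -> : partial k (cutoff r) = fun x => - 2 * (x 0 k / r ^+ 2) * cutoff_omit r k x.
  by apply/funext => y; exact: cutoff_partial.
have -> : (fun x => - 2 * (x 0 k / r ^+ 2) * cutoff_omit r k x) =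
    fun x => (- 2 / r ^+ 2) * x 0 k * cutoff_omit r k x.
  by apply/funext => y; congr (_ * _); rewrite -!mulrA; congr (_ * _); rewrite mulrC.
have d := is_derive_mul (is_derive_mul (is_derive_const (- 2 / r ^+ 2) x (delta_mx 0 k))
  (coord_derive k x)) (cutoff_omit_derive r k x).
by apply: partial_val; apply: (is_derive_eq d); rewrite /=; ring.
Qed.

Lemma cutoff_factor_itv r x k : 0 < r -> in_cube r x ->
  0 <= 1 - (x 0 k / r) ^+ 2 <= 1.
Proof.
move=> r0 /(_ k)/andP[x1 x2].
have : `|x 0 k / r| <= 1.
  by rewrite normrM normfV (gtr0_norm r0) ler_pdivrMr// mul1r ler_norml x1.
by rewrite -real_normK ?num_real// => h; have := normr_ge0 (x 0 k / r); nra.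
Qed.

Lemma cutoff_itv r x : 0 < r -> in_cube r x -> 0 <= cutoff r x <= 1.
Proof.
move=> r0 xr; rewrite prodr_ge0 => [|i _]; last by have /andP[] := cutoff_factor_itv i r0 xr.
by apply: prodr_ile1 => i _; exact: cutoff_factor_itv.
Qed.

Lemma cutoff_omit_itv r k x : 0 < r -> in_cube r x -> 0 <= cutoff_omit r k x <= 1.
Proof.
move=> r0 xr; rewrite prodr_ge0 => [|i _]; last by have /andP[] := cutoff_factor_itv i r0 xr.
by apply: prodr_ile1 => i _; exact: cutoff_factor_itv.
Qed.

Lemma cutoff_face r i y : 0 < r -> `|y 0 i| = r -> cutoff r y = 0.
Proof.
move=> r0 yr; rewrite (cutoffE r i) -real_normK ?num_real// normrM normfV yr (gtr0_norm r0).
by rewrite divff ?gt_eqF// expr1n subrr mul0r.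
Qed.

Lemma cutoff_partial_sqr r k x : 0 < r -> in_cube r x ->
  partial k (cutoff r) x ^+ 2 <= 4 / r ^+ 2.
Proof.
move=> r0 xr; rewrite cutoff_partial.
have /andP[c0 c1] := cutoff_omit_itv k r0 xr.
have /andP[x1 x2] := xr k.
have -> : (- 2 * (x 0 k / r ^+ 2) * cutoff_omit r k x) ^+ 2 =
   4 / r ^+ 2 * ((x 0 k / r) ^+ 2 * cutoff_omit r k x ^+ 2).
  by field; rewrite gt_eqF.
have := cutoff_factor_itv k r0 xr; rewrite subr_ge0 => /andP[h _].
rewrite ler_piMr// ?divr_ge0// ?sqr_ge0//.
by rewrite mulr_ile1// ?sqr_ge0// expr_le1.
Qed.

Lemma cutoff_partial2_ge r k x : 0 < r -> in_cube r x ->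
  - (2 / r ^+ 2) <= partial k (partial k (cutoff r)) x.
Proof.
move=> r0 xr; rewrite cutoff_partial2 -mulNr -[leLHS]mulr1 ler_wnM2l//.
  by rewrite mulNr oppr_le0 divr_ge0// sqr_ge0.
by have /andP[] := cutoff_omit_itv k r0 xr.
Qed.

(** Each factor is at least 1 - 1/4. The bound does not depend on [r'], so it persists as the outer
    cube grows. *)
Lemma cutoff_half_ge r r' x : 0 < r -> 2 * r <= r' -> in_cube r x ->
  (3 / 4) ^+ n <= cutoff r' x.
Proof.
move=> r0 rr' xr; have r'0 : 0 < r' by lra.
have {1}-> : n = #|'I_n| by rewrite card_ord.
rewrite -prodr_const; apply: ler_prod => i _; apply/andP; split; first by lra.
have : `|x 0 i / r'| <= 1 / 2.
  rewrite normrM normfV (gtr0_norm r'0) ler_pdivrMr// ler_norml.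
  by have /andP[] := xr i; lra.
by rewrite -real_normK ?num_real// => h; have := normr_ge0 (x 0 i / r'); nra.
Qed.

Lemma cubeint_divergence r (X : 'I_n -> 'rV[R]_n -> R) : 0 < r ->
  (forall k, Ck 1 (X k)) -> (forall k y, `|y 0 k| = r -> X k y = 0) ->
  cubeint r (enum 'I_n) (fun x => \sum_k partial k (X k) x) = fun=> 0.
Proof.
move=> r0 cX X0.
have cP k : continuous (partial k (X k)) := Ck_continuous (Ck_partial k (cX k)).
elim: (index_enum _) => [|a s IH].
  under [X in cubeint _ _ X]eq_fun do rewrite big_nil.
  by rewrite cubeint_cst//; apply/funext => x; rewrite mul0r.
under [X in cubeint _ _ X]eq_fun do rewrite big_cons.
rewrite cubeintD// ?IH; last first.
  apply: (@Ck_continuous _ _ 0); apply: Ck_sum => k; exact: Ck_partial (cX k).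
rewrite (@cubeint_partial0 _ _ r _ a)//; last 3 first.
- exact: enum_uniq.
- by rewrite mem_enum.
- exact: X0.
by apply/funext => x; rewrite addr0.
Qed.

(** All integrations by parts below take this form: a field containing a power of the cutoff is
    chosen, and only a pointwise inequality is left to prove. *)
Lemma cubeint_le_divergence r (X : 'I_n -> 'rV[R]_n -> R) (f h : 'rV[R]_n -> R) :
  0 < r -> continuous f -> continuous h ->
  (forall k, Ck 1 (X k)) -> (forall k y, `|y 0 k| = r -> X k y = 0) ->
  (forall y, in_cube r y -> f y + \sum_k partial k (X k) y <= h y) ->
  forall x, in_cube r x -> cubeint r (enum 'I_n) f x <= cubeint r (enum 'I_n) h x.
Proof.
move=> r0 cf ch cX X0 fh x xr.
have cD : continuous (fun y => \sum_k partial k (X k) y).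
  by apply: (@Ck_continuous _ _ 0); apply: Ck_sum => k; exact: Ck_partial (cX k).
have := @cubeint_le _ _ r (enum 'I_n) _ h r0 (cont_add cf cD) ch fh x xr.
by rewrite cubeintD// cubeint_divergence// addr0.
Qed.

End Cutoff.

(** * Entire solutions *)

Section Liouville.
Variables (R : realType) (v : 'rV[R]_4 -> R).
Hypothesis cv : forall m, Ck m v.
Hypothesis v_gt0 : forall x, 0 < v x.
Hypothesis lap_v : forall x, \sum_k partial k (partial k v) x = - 2 * v x ^+ 3.
Implicit Types (x y : 'rV[R]_4) (i k : 'I_4) (r : R).

Let w x := (v x)^-1.
Let P x := \sum_k partial k (partial k w) x.
Let S x := Num.sqrt (P x).

Let v_neq0 x : v x != 0. Proof. by rewrite gt_eqF. Qed.

Let cw m : Ck m w. Proof. exact: Ck_inv. Qed.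

Let w_gt0 x : 0 < w x. Proof. by rewrite invr_gt0. Qed.

Let cdw m i : Ck m (partial i w). Proof. exact: Ck_partial. Qed.

Let cP m : Ck m P.
Proof. by apply: Ck_sum => k; do 2 apply: Ck_partial. Qed.

Let dC f k x : (forall m, Ck m f) -> is_derive x (delta_mx 0 k) f (partial k f x).
Proof. by move=> cf; exact: Ck_is_derive (cf 1%N). Qed.

(** * Pointwise identities for w, P and S *)

Lemma partial_v k x : partial k v x = - (partial k w x * v x ^+ 2).
Proof.
have /partial_val -> := is_derive_inv (v_neq0 x) (dC k x cv).
by field.
Qed.

(** As grad v = - v^2 grad w, one has P = - w^2 Lap v + 2 v |grad w|^2, and the equation turns the
    first term into 2 v. *)
Lemma w_lap_w x : w x * P x = 2 * \sum_k partial k w x ^+ 2 + 2.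
Proof.
have E k : partial k (partial k w) x =
    - (partial k (partial k v) x * w x ^+ 2) + 2 * partial k w x ^+ 2 * v x.
  have -> : partial k w = fun y => -1 * (partial k v y * (w y * w y)).
    apply/funext => y; rewrite mulN1r; apply: partial_val.
    exact: is_derive_inv (v_neq0 y) (dC k y cv).
  have d := is_derive_mul (is_derive_const (-1) x (delta_mx 0 k))
    (is_derive_mul (dC k x (fun m => Ck_partial k (cv m.+1)))
      (is_derive_mul (dC k x cw) (dC k x cw))).
  rewrite (partial_val d) /=.
  rewrite (partial_v k x) /w; field.
  exact: v_neq0.
rewrite /P (eq_bigr _ (fun k _ => E k)) big_split /= sumrN -!mulr_suml lap_v.
by rewrite -mulr_sumr /w; field; exact: v_neq0.
Qed.

Lemma partial_w_lap_w k x : partial k w x * P x + w x * partial k P x =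
  4 * \sum_i partial i w x * partial k (partial i w) x.
Proof.
have e : (fun y => w y * P y) = (fun y => 2 * (\sum_i partial i w y * partial i w y) + 2).
  by apply/funext => y; rewrite w_lap_w; congr (2 * _ + 2).
have d1 := is_derive_mul (dC k x cw) (dC k x cP).
have d2 : is_derive x (delta_mx 0 k) (fun y => 2 * (\sum_i partial i w y * partial i w y) + 2)
    (0 * (\sum_i partial i w x * partial i w x) +
     2 * (\sum_i (partial k (partial i w) x * partial i w x
        + partial i w x * partial k (partial i w) x)) + 0).
  apply: is_derive_add (is_derive_const 2 _ _).
  apply: is_derive_mul (is_derive_const 2 _ _) _.
  by apply: is_derive_bigsum => i; apply: is_derive_mul; exact: dC.
rewrite -(partial_val d1) e (partial_val d2) mul0r add0r addr0.
by rewrite !mulr_sumr; apply: eq_bigr => i _; ring.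
Qed.

Lemma third_partial_sum i x :
  \sum_k partial k (partial k (partial i w)) x = partial i P x.
Proof.
have d : is_derive x (delta_mx 0 i) P (\sum_k partial i (partial k (partial k w)) x).
  by apply: is_derive_bigsum => k; apply: dC => m; do 2 apply: Ck_partial.
rewrite (partial_val d); apply: eq_bigr => k _.
have -> : partial k (partial i w) = partial i (partial k w).
  by apply/funext => y; exact: schwarz.
exact: schwarz.
Qed.

(** [partial_w_lap_w] is differentiated in direction k and summed over k. The right side is 4
    |E|^2. *)
Lemma w_lap_P x : w x * \sum_k partial k (partial k P) x
    - 2 * \sum_k partial k w x * partial k P x =
  4 * \sum_k \sum_i partial k (partial i w) x ^+ 2 - P x ^+ 2.
Proof.
have e k : partial k (partial k w) x * P x + 2 * (partial k w x * partial k P x)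
    + w x * partial k (partial k P) x =
    4 * (\sum_i partial k (partial i w) x ^+ 2 +
         \sum_i partial i w x * partial k (partial k (partial i w)) x).
  have d1 := is_derive_add (is_derive_mul (dC k x (cdw ^~ k)) (dC k x cP))
    (is_derive_mul (dC k x cw) (dC k x (fun m => Ck_partial k (cP m.+1)))).
  have d2 : is_derive x (delta_mx 0 k)
      (fun y => 4 * \sum_i partial i w y * partial k (partial i w) y)
      (0 * (\sum_i partial i w x * partial k (partial i w) x) +
       4 * (\sum_i (partial k (partial i w) x * partial k (partial i w) x
         + partial i w x * partial k (partial k (partial i w)) x))).
    apply: is_derive_mul (is_derive_const 4 _ _) _.
    apply: is_derive_bigsum => i; apply: is_derive_mul; apply: dC => // m.
    exact: Ck_partial.
  have := partial_val d1; have := partial_val d2.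
  under eq_fun do rewrite -partial_w_lap_w.
  move=> ->; rewrite mul0r add0r big_split /= => E.
  have alg (a b c d u : R) : a * b + 2 * (c * d) + u = a * b + c * d + (c * d + u) by ring.
  by rewrite alg; exact: esym E.
exact: (bochner_sum e erefl (third_partial_sum ^~ x)).
Qed.

Let P_gt0 x : 0 < P x.
Proof.
rewrite -(pmulr_rgt0 _ (w_gt0 x)) w_lap_w ltr_wpDl// mulr_ge0//.
by apply: sumr_ge0 => k _; exact: sqr_ge0.
Qed.

Let S_gt0 x : 0 < S x. Proof. by rewrite sqrtr_gt0. Qed.

Let PE x : P x = S x * S x. Proof. by rewrite -expr2 sqr_sqrtr// ltW. Qed.

Let cS m : Ck m S. Proof. exact: Ck_sqrt. Qed.

Let cdS m i : Ck m (partial i S). Proof. exact: Ck_partial. Qed.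

Let cdv m i : Ck m (partial i v). Proof. exact: Ck_partial. Qed.

Lemma partial_P k x : partial k P x = 2 * (S x * partial k S x).
Proof.
have -> : P = fun y => S y * S y by apply/funext => y; exact: PE.
rewrite (partial_val (is_derive_mul (dC k x cS) (dC k x cS))).
by move: (S x) (partial k S x) => a b; ring.
Qed.

Lemma partial2_P k x : partial k (partial k P) x =
  2 * (partial k S x ^+ 2 + S x * partial k (partial k S) x).
Proof.
have -> : partial k P = fun y => 2 * (S y * partial k S y).
  by apply/funext => y; exact: partial_P.
have d := is_derive_mul (is_derive_const 2 x (delta_mx 0 k))
  (is_derive_mul (dC k x cS) (dC k x (cdS ^~ k))).
by rewrite (partial_val d) mul0r add0r expr2.
Qed.

Lemma gradient_S_bound x : w x * \sum_k partial k S x ^+ 2 <=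
  3 * S x * (w x * \sum_k partial k (partial k S) x
             - 2 * \sum_k partial k w x * partial k S x).
Proof.
exact: (sqrt_gradient_bound (w_gt0 x) (S_gt0 x) (PE x) (fun k i => schwarz i k x (cw 2)) erefl
  (w_lap_w x) (partial_w_lap_w ^~ x) (partial_P ^~ x) (partial2_P ^~ x) (w_lap_P x)).
Qed.

(** * Integral estimates on cubes *)

Let cutoffI r y : 0 < r -> in_cube r y -> 0 <= cutoff r y /\ cutoff r y <= 1.
Proof. by move=> r0 /(cutoff_itv r0)/andP. Qed.

Let cc r m : Ck m (cutoff r : 'rV[R]_4 -> R). Proof. exact: cutoff_Ck. Qed.

Let dcut r k y : is_derive y (delta_mx 0 k) (cutoff r) (partial k (cutoff r) y).
Proof. by apply: dC => m; exact: cutoff_Ck. Qed.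

(** Green's second identity: X = psi^3 grad v - v grad psi^3 has div X = psi^3 Lap v - v Lap psi^3,
    free of derivatives of v. The equation gives -2 psi^3 v^3, and Lap psi^3 >= -24 psi / r^2 costs
    an error that [cubic_young] absorbs. *)
Lemma cube_v3 r x : 0 < r -> in_cube r x ->
  cubeint r (enum 'I_4) (fun y => cutoff r y ^+ 3 * v y ^+ 3) x <= 864 * r.
Proof.
move=> r0 xr.
pose X k y := cutoff r y ^+ 3 * partial k v y
  + -1 * (v y * (3 * cutoff r y ^+ 2 * partial k (cutoff r) y)).
have dX k y : partial k (X k) y = cutoff r y ^+ 3 * partial k (partial k v) y
    - v y * (6 * cutoff r y * partial k (cutoff r) y ^+ 2
             + 3 * cutoff r y ^+ 2 * partial k (partial k (cutoff r)) y).
  have d := is_derive_add (is_derive_mul (is_derive_exp 2 (dcut r k y)) (dC k y (cdv ^~ k)))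
    (is_derive_mul (is_derive_const (-1) y (delta_mx 0 k)) (is_derive_mul (dC k y cv)
      (is_derive_mul (is_derive_mul (is_derive_const 3 y (delta_mx 0 k))
         (is_derive_exp 1 (dcut r k y))) (dC k y (fun m => Ck_partial k (cc r m.+1)))))).
  rewrite (partial_val d).
  move: (cutoff r y) (v y) (partial k (partial k v) y) (partial k v y)
    (partial k (partial k (cutoff r)) y) (partial k (cutoff r) y) => a b c e f g.
  ring.
have le_cst : forall y, in_cube r y ->
    cutoff r y ^+ 3 * v y ^+ 3 + \sum_k partial k (X k) y <= 54 * r^-1 ^+ 3.
  move=> y yr; have [c0 c1] := cutoffI r0 yr.
  have v0 := v_gt0 y; have a0 : 0 < r^-1 by rewrite invr_gt0.
  rewrite (eq_bigr _ (fun k _ => dX k y)) sumrB -!mulr_sumr lap_v.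
  have lb : - (24 * cutoff r y * r^-1 ^+ 2) <= \sum_k (6 * cutoff r y * partial k (cutoff r) y ^+ 2
             + 3 * cutoff r y ^+ 2 * partial k (partial k (cutoff r)) y).
    have -> : - (24 * cutoff r y * r^-1 ^+ 2) = \sum_(k < 4) - (6 * cutoff r y * r^-1 ^+ 2).
      by rewrite sumr_const card_ord -mulr_natl; ring.
    apply: ler_sum => k _.
    have := cutoff_partial2_ge k r0 yr.
    have := mulr_ge0 c0 (sqr_ge0 (partial k (cutoff r) y)).
    rewrite -exprVn.
    move: c0 c1 a0; move: (cutoff r y) (partial k (partial k (cutoff r)) y)
      (partial k (cutoff r) y) r^-1 => c d e a c0 c1 a0 h1 h2.
    have : c ^+ 2 * (- (2 * a ^+ 2)) <= c ^+ 2 * d by rewrite ler_wpM2l// sqr_ge0.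
    have : c ^+ 2 * a ^+ 2 <= c * a ^+ 2.
      by rewrite ler_wpM2r ?sqr_ge0// expr2 ler_piMr.
    lra.
  have := cubic_young (mulr_ge0 c0 (ltW v0)) (ltW a0).
  have := ler_wpM2l (ltW v0) lb.
  move: (\sum_(k < 4) (_ + _)) => s.
  move: (cutoff r y) (v y) r^-1 => c u a h1 h2.
  rewrite exprMn in h2; lra.
have -> : 864 * r = 54 * r^-1 ^+ 3 * (2 * r) ^+ size (enum 'I_4).
  by rewrite size_enum_ord; field; rewrite gt_eqF.
have := @cubeint_le_divergence _ _ r X _ (fun=> 54 * r^-1 ^+ 3) r0 _ _ _ _ le_cst x xr.
rewrite cubeint_cst//; apply.
- by apply: (@Ck_continuous _ _ 0); apply: Ck_mul; apply: Ck_exp.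
- exact: cst_continuous.
- move=> k; apply: Ck_add; first by apply: Ck_mul => //; exact: Ck_exp.
  apply: Ck_mul; first exact: Ck_cst.
  apply: Ck_mul => //; apply: Ck_mul; last exact: Ck_partial.
  by apply: Ck_mul; [exact: Ck_cst|exact: Ck_exp].
- by move=> k y yr; rewrite /X (cutoff_face r0 yr) !expr0n /= !mul0r !mulr0 mul0r !mulr0 addr0.
Qed.

Let partial_cutoff_sum r y : 0 < r -> in_cube r y ->
  \sum_k partial k (cutoff r) y ^+ 2 <= 16 * r^-1 ^+ 2.
Proof.
move=> r0 yr; have -> : 16 * r^-1 ^+ 2 = \sum_(k < 4) 4 / r ^+ 2.
  by rewrite sumr_const card_ord -mulr_natl exprVn; ring.
by apply: ler_sum => k _; exact: cutoff_partial_sqr.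
Qed.

(** The field is 4 psi^2 grad ln v. Since v P = 2 v^2 + 2 |grad ln v|^2 while -4 Lap ln v = 8 v^2 +
    4 |grad ln v|^2, a term 2 psi^2 |grad ln v|^2 is left over to complete the square with the cross
    term. *)
Lemma cube_vP r x : 0 < r -> in_cube r x ->
  cubeint r (enum 'I_4) (fun y => cutoff r y ^+ 2 * (v y * P y)) x <= 2048 * r ^+ 2.
Proof.
move=> r0 xr.
pose X k y := 4 * (cutoff r y ^+ 2 * (partial k v y * w y)).
have dX k y : partial k (X k) y = 4 * cutoff r y ^+ 2 * w y * partial k (partial k v) y
   - 4 * cutoff r y ^+ 2 * v y ^+ 2 * partial k w y ^+ 2
   - 8 * cutoff r y * v y * partial k (cutoff r) y * partial k w y.
  have d := is_derive_mul (is_derive_const 4 y (delta_mx 0 k))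
    (is_derive_mul (is_derive_exp 1 (dcut r k y))
      (is_derive_mul (dC k y (cdv ^~ k)) (dC k y cw))).
  rewrite (partial_val d) partial_v /w.
  move: (partial k (partial k v) y) (partial k (fun x => (v x)^-1) y)
    (partial k (cutoff r) y) (cutoff r y) (v_neq0 y); move: (v y) => u a b c e u0.
  by field.
have le_cst : forall y, in_cube r y ->
    cutoff r y ^+ 2 * (v y * P y) + \sum_k partial k (X k) y <= 128 * r^-1 ^+ 2.
  move=> y yr.
  have := partial_cutoff_sum r0 yr; have := w_lap_w y.
  rewrite (eq_bigr _ (fun k _ => dX k y)) !sumrB -!mulr_sumr lap_v.
  have -> : \sum_k 8 * cutoff r y * v y * partial k (cutoff r) y * partial k w y =
     8 * cutoff r y * v y * \sum_k partial k (cutoff r) y * partial k w y.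
    by rewrite mulr_sumr; apply: eq_bigr => k _; rewrite !mulrA.
  have : 0 <= \sum_k (cutoff r y * v y * partial k w y + 2 * partial k (cutoff r) y) ^+ 2.
    by apply: sumr_ge0 => k _; exact: sqr_ge0.
  have -> : \sum_k (cutoff r y * v y * partial k w y + 2 * partial k (cutoff r) y) ^+ 2 =
    (cutoff r y * v y) ^+ 2 * \sum_k partial k w y ^+ 2
    + 4 * (cutoff r y * v y) * (\sum_k partial k (cutoff r) y * partial k w y)
    + 4 * \sum_k partial k (cutoff r) y ^+ 2.
    rewrite !mulr_sumr -!big_split /=; apply: eq_bigr => k _.
    move: (partial k w y) (partial k (cutoff r) y) (cutoff r y) (v y) => a b c u.
    by ring.
  have := v_neq0 y; have := v_gt0 y; rewrite /w.
  have := sqr_ge0 (cutoff r y * v y).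
  have := mulr_ge0 (sqr_ge0 (cutoff r y * v y))
    (sumr_ge0 (index_enum 'I_4) (fun k _ => sqr_ge0 (partial k w y))).
  rewrite -/w.
  move: (\sum_k partial k (cutoff r) y ^+ 2) (\sum_k partial k (cutoff r) y * partial k w y)
    (\sum_k partial k w y ^+ 2) => a b c.
  move: (P y) (cutoff r y) (v y) r^-1 => p e u q.
  move=> h1 h2 u0 un0 h3 h4 h5.
  have -> : p = u * (2 * c + 2) by rewrite -h4 mulVKf.
  have -> : 4 * e ^+ 2 * u^-1 * (- 2 * u ^+ 3) = - 8 * (e * u) ^+ 2 by field.
  have -> : e ^+ 2 * (u * (u * (2 * c + 2))) = (e * u) ^+ 2 * (2 * c + 2) by ring.
  lra.
have -> : 2048 * r ^+ 2 = 128 * r^-1 ^+ 2 * (2 * r) ^+ size (enum 'I_4).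
  by rewrite size_enum_ord; field; rewrite gt_eqF.
have := @cubeint_le_divergence _ _ r X _ (fun=> 128 * r^-1 ^+ 2) r0 _ _ _ _ le_cst x xr.
rewrite cubeint_cst//; apply.
- apply: (@Ck_continuous _ _ 0); apply: Ck_mul; first exact: Ck_exp.
  exact: Ck_mul.
- exact: cst_continuous.
- move=> k; apply: Ck_mul; first exact: Ck_cst.
  by apply: Ck_mul; [exact: Ck_exp|exact: Ck_mul].
- by move=> k y yr; rewrite /X (cutoff_face r0 yr) expr0n /= mul0r mulr0.
Qed.

Let gradS_density y := v y ^+ 2 * (\sum_k partial k S y ^+ 2) * (S y)^-1.

Let S_neq0 y : S y != 0. Proof. by rewrite gt_eqF. Qed.

Let gradS_density_continuous : continuous gradS_density.
Proof.
apply: (@Ck_continuous _ _ 0); apply: Ck_mul; last exact: Ck_inv.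
apply: Ck_mul; first exact: Ck_exp.
by apply: Ck_sum => k; exact: Ck_exp.
Qed.

Let gradS_density_ge0 y : 0 <= gradS_density y.
Proof.
apply: mulr_ge0; last by rewrite invr_ge0 ltW.
apply: mulr_ge0; first exact: sqr_ge0.
by apply: sumr_ge0 => k _; exact: sqr_ge0.
Qed.

(** The free weight [l] stands in for the Cauchy-Schwarz inequality between the integrals of
    [cube_vP] and [cube_v3]; l of order r^(-1/2) would give the rate r^(-1/2). *)
Lemma cube_gradS r l x : 0 < r -> 0 < l -> in_cube r x ->
  cubeint r (enum 'I_4) (fun y => cutoff r y ^+ 5 * gradS_density y) x
    <= 1800 * (2048 * l + 864 / (l * r)).
Proof.
move=> r0 l0 xr.
pose X k y := - 6 * (cutoff r y ^+ 5 * (v y ^+ 2 * partial k S y)).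
have dX k y : partial k (X k) y =
   - 30 * cutoff r y ^+ 4 * v y ^+ 2 * (partial k (cutoff r) y * partial k S y)
   + 12 * cutoff r y ^+ 5 * v y ^+ 3 * (partial k w y * partial k S y)
   - 6 * cutoff r y ^+ 5 * v y ^+ 2 * partial k (partial k S) y.
  have d := is_derive_mul (is_derive_const (- 6) y (delta_mx 0 k))
    (is_derive_mul (is_derive_exp 4 (dcut r k y))
      (is_derive_mul (is_derive_exp 1 (dC k y cv)) (dC k y (cdS ^~ k)))).
  rewrite (partial_val d) partial_v.
  move: (partial k (partial k S) y) (partial k S y) (partial k w y)
    (partial k (cutoff r) y) (cutoff r y) (v y) => a b c e f u.
  by ring.
pose h y := 1800 * r^-1 ^+ 2 * (l * (cutoff r y ^+ 2 * (v y * P y))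
                               + l^-1 * (cutoff r y ^+ 3 * v y ^+ 3)).
have le_h : forall y, in_cube r y ->
    cutoff r y ^+ 5 * gradS_density y + \sum_k partial k (X k) y <= h y.
  move=> y yr; have [c0 c1] := cutoffI r0 yr.
  have := partial_cutoff_sum r0 yr.
  rewrite (eq_bigr _ (fun k _ => dX k y)) sumrB big_split /= -!mulr_sumr.
  have := gradient_S_bound y.
  have : 0 <= \sum_k (cutoff r y * partial k S y + 15 * S y * partial k (cutoff r) y) ^+ 2.
    by apply: sumr_ge0 => k _; exact: sqr_ge0.
  have -> : \sum_k (cutoff r y * partial k S y + 15 * S y * partial k (cutoff r) y) ^+ 2 =
    cutoff r y ^+ 2 * (\sum_k partial k S y ^+ 2)
    + 30 * (cutoff r y * S y) * (\sum_k partial k (cutoff r) y * partial k S y)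
    + 225 * S y ^+ 2 * \sum_k partial k (cutoff r) y ^+ 2.
    rewrite !mulr_sumr -!big_split /=; apply: eq_bigr => k _.
    move: (partial k S y) (partial k (cutoff r) y) (cutoff r y) (S y) => a b c s.
    by ring.
  rewrite /h /gradS_density (PE y) -/(w y).
  have ia0 : 0 < r^-1 by rewrite invr_gt0.
  move: c0 c1 (S_gt0 y) (v_gt0 y) ia0; rewrite /w.
  move: (\sum_k partial k (cutoff r) y ^+ 2) (\sum_k partial k S y ^+ 2)
     (\sum_k partial k (cutoff r) y * partial k S y)
     (\sum_k partial k (partial k S) y)
     (\sum_k partial k (fun x => (v x)^-1) y * partial k S y) => a b g q p.
  move: (cutoff r y) (S y) (v y) r^-1 => c s u t.
  exact: gradS_pointwise.
have := @cubeint_le_divergence _ _ r X _ h r0 _ _ _ _ le_h x xr.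
have cvP : continuous (fun y => cutoff r y ^+ 2 * (v y * P y)).
  apply: (@Ck_continuous _ _ 0); apply: Ck_mul; first exact: Ck_exp.
  exact: Ck_mul.
have cv3 : continuous (fun y => cutoff r y ^+ 3 * v y ^+ 3).
  by apply: (@Ck_continuous _ _ 0); apply: Ck_mul; apply: Ck_exp.
have ccst (c : R) : continuous (fun _ : 'rV[R]_4 => c) by exact: cst_continuous.
have hE : cubeint r (enum 'I_4) h x = 1800 * r^-1 ^+ 2 *
   (l * cubeint r (enum 'I_4) (fun y => cutoff r y ^+ 2 * (v y * P y)) x
    + l^-1 * cubeint r (enum 'I_4) (fun y => cutoff r y ^+ 3 * v y ^+ 3) x).
  have clP := cont_mul (ccst l) cvP; have cl3 := cont_mul (ccst l^-1) cv3.
  rewrite /h cubeintZ//; last exact: cont_add clP cl3.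
  by rewrite cubeintD// !cubeintZ.
rewrite hE => H; apply: le_trans (H _ _ _ _) _.
- exact: cont_mul (Ck_continuous (Ck_exp 5 (cc r 0))) gradS_density_continuous.
- exact: cont_mul (ccst _) (cont_add (cont_mul (ccst l) cvP) (cont_mul (ccst l^-1) cv3)).
- move=> k; apply: Ck_mul; first exact: Ck_cst.
  apply: Ck_mul; first exact: Ck_exp.
  by apply: Ck_mul => //; exact: Ck_exp.
- by move=> k y yr; rewrite /X (cutoff_face r0 yr) expr0n /= mul0r mulr0.
have -> : 1800 * (2048 * l + 864 / (l * r)) =
   1800 * r^-1 ^+ 2 * (l * (2048 * r ^+ 2) + l^-1 * (864 * r)).
  by field; rewrite !gt_eqF.
apply: ler_wpM2l; first by apply: mulr_ge0; [exact: ler0n|exact: sqr_ge0].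
apply: lerD; apply: ler_wpM2l.
- exact: ltW.
- exact: cube_vP.
- by rewrite invr_ge0 ltW.
- exact: cube_v3.
Qed.

Lemma partial_S0 k x : partial k S x = 0.
Proof.
suff : gradS_density x <= 0.
  move=> G0; have : gradS_density x = 0 by apply/le_anti; rewrite G0 gradS_density_ge0.
  move/eqP; rewrite !mulf_eq0 invr_eq0 (negbTE (S_neq0 x)) orbF (negbTE (v_neq0 x)) /=.
  rewrite psumr_eq0 => [/allP/(_ k (mem_index_enum _))|j _]; last exact: sqr_ge0.
  by rewrite /= sqrf_eq0 => /eqP.
rewrite leNgt; apply/negP => Gx.
(* A fixed cube around the point [x] where the density is supposed positive; its integral there
   bounds from below those over all larger cubes. *)
pose r0 := 1 + \sum_j `|x 0 j|.
have r00 : 0 < r0 by rewrite ltr_pwDl// sumr_ge0.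
have xr0 : in_cube r0 x.
  move=> j; rewrite -ler_norml /r0 (bigD1 j)//= addrCA lerDl addr_ge0//.
  exact: sumr_ge0.
have [c c0 chalf] : exists2 c : R, 0 < c &
    forall r y, 2 * r0 <= r -> in_cube r0 y -> c <= cutoff r y.
  exists ((3 / 4) ^+ 4); first by apply: exprn_gt0; rewrite divr_gt0.
  by move=> r y; exact: cutoff_half_ge.
have ccG : continuous (fun y => c ^+ 5 * gradS_density y).
  by apply: cont_mul => //; exact: cst_continuous.
pose K := cubeint r0 (enum 'I_4) (fun y => c ^+ 5 * gradS_density y) x.
have K0 : 0 < K.
  apply: cubeint_gt0 => //; last by apply: mulr_gt0 => //; exact: exprn_gt0.
  move=> y _; apply: mulr_ge0; last exact: gradS_density_ge0.
  by apply: exprn_ge0; exact: ltW.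
have bound r l : 2 * r0 <= r -> 0 < l -> K <= 1800 * (2048 * l + 864 / (l * r)).
  move=> rr0 l0.
  have r0r : r0 <= r by lra.
  have rp : 0 < r by lra.
  have xr : in_cube r x by move=> j; have /andP[] := xr0 j; lra.
  have cuG : continuous (fun y => cutoff r y ^+ 5 * gradS_density y).
    exact: cont_mul (Ck_continuous (Ck_exp 5 (cc r 0))) gradS_density_continuous.
  apply: le_trans (cube_gradS rp l0 xr).
  apply: (@le_trans _ _ (cubeint r0 (enum 'I_4) (fun y => cutoff r y ^+ 5 * gradS_density y) x)).
    apply: cubeint_le => // y yr0; apply: ler_wpM2r; first exact: gradS_density_ge0.
    apply: lerXn2r; rewrite ?nnegrE; first exact: ltW.
      exact: le_trans (ltW c0) (chalf _ _ rr0 yr0).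
    exact: chalf.
  apply: cubeint_widen => // y yr; apply: mulr_ge0; last exact: gradS_density_ge0.
  by apply: exprn_ge0; have [] := cutoffI rp yr.
have [A [B [A0 B0 {}bound]]] : exists A B : R, [/\ 0 < A, 0 < B &
    forall r l, 2 * r0 <= r -> 0 < l -> K <= A * l + B / (l * r)].
  exists (1800 * 2048), (1800 * 864); split.
  - by apply: mulr_gt0; rewrite ltr0n.
  - by apply: mulr_gt0; rewrite ltr0n.
  - by move=> r l rr0 l0; rewrite -!mulrA -mulrDr; exact: bound.
(* This [l] makes A l = K/4, and then r >= 4 B / (l K) makes B / (l r) <= K/4, so that K <= K/2. *)
pose l := K / (4 * A).
have l0 : 0 < l by apply: divr_gt0 => //; exact: mulr_gt0.
have q0 : 0 < 4 * B / (l * K) by apply: divr_gt0; exact: mulr_gt0.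
have r1 : 4 * B / (l * K) <= 2 * r0 + 4 * B / (l * K) by rewrite lerDr; apply: mulr_ge0 => //; exact: ltW.
have rr0 : 2 * r0 <= 2 * r0 + 4 * B / (l * K) by rewrite lerDl ltW.
have := bound _ l rr0 l0; move: r1 (lt_le_trans q0 r1).
move: (2 * r0 + _) => r; rewrite ler_pdivrMr; last exact: mulr_gt0.
move=> r1 r_gt0.
apply/negP; rewrite -ltNge.
have -> : A * l = K / 4 by rewrite /l; field; rewrite gt_eqF.
have : B / (l * r) <= K / 4 by rewrite ler_pdivrMr; [lra|exact: mulr_gt0].
lra.
Qed.

(** * Integration of the rigid Hessian *)

Lemma laplacian_w_const x : P x = P 0.
Proof.
have := @partial0_const _ _ S (cS 1) partial_S0 x 0.
by rewrite !PE => ->.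
Qed.

Lemma hessian_w k i x : partial k (partial i w) x = P 0 / 4 * (k == i)%:R.
Proof.
rewrite -(laplacian_w_const x); apply: (@hessian_rigid _ _ (fun k i => partial k (partial i w) x)) => //.
have := w_lap_P x.
have p0 j : partial j P x = 0 by rewrite partial_P partial_S0 !mulr0.
have pp0 j : partial j (partial j P) x = 0.
  rewrite partial2_P partial_S0.
  have -> : partial j S = fun=> 0 by apply/funext => y; exact: partial_S0.
  by rewrite (partial_val (is_derive_const 0 x (delta_mx 0 j))) expr0n mulr0 addr0 mulr0.
have z1 : \sum_j partial j (partial j P) x = 0 by apply: big1 => j _; exact: pp0.
have z2 : \sum_j partial j w x * partial j P x = 0.
  by apply: big1 => j _; rewrite p0 mulr0.
by rewrite z1 z2 !mulr0 subrr => /esym/eqP; rewrite subr_eq0 => /eqP.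
Qed.

(** The critical point of w, found from grad w at the origin and the Hessian P(0)/4 Id. *)
Let a : 'rV[R]_4 := \row_i (- (4 / P 0 * partial i w 0)).

Let P0_neq0 : P 0 != 0. Proof. by rewrite gt_eqF. Qed.

Lemma gradient_w i x : partial i w x = P 0 / 4 * (x 0 i - a 0 i).
Proof.
pose f x := partial i w x + - (P 0 / 4) * x 0 i.
have cf : Ck 1 f.
  by apply: Ck_add => //; apply: Ck_mul; [exact: Ck_cst|exact: Ck_coord].
have df k y : partial k f y = 0.
  have d := is_derive_add (dC k y (cdw ^~ i))
    (is_derive_mul (is_derive_const (- (P 0 / 4)) y (delta_mx 0 k)) (is_derive_coord y k i)).
  by rewrite (partial_val d) hessian_w mul0r add0r eq_sym mulNr subrr.
have := partial0_const cf df x 0; rewrite /f !mxE mulr0 addr0.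
have -> : P 0 / 4 * (x 0 i - - (4 / P 0 * partial i w 0)) = P 0 / 4 * x 0 i + partial i w 0.
  by move: P0_neq0; move: (P 0) (x 0 i) (partial i w 0) => p b c p0; field.
by move=> <-; rewrite mulNr addrC subrK.
Qed.

(** The constant term is w(a): at [a] the gradient vanishes and [w_lap_w] reads w(a) P(0) = 2. *)
Lemma w_quadratic x : w x = P 0 / 8 * (\sum_i (x 0 i - a 0 i) ^+ 2) + 2 / P 0.
Proof.
pose f x := w x + - (P 0 / 8) * \sum_i (x 0 i + - a 0 i) ^+ 2.
have cb i : forall m, Ck m (fun x : 'rV[R]_4 => (x 0 i + - a 0 i) ^+ 2).
  by move=> m; apply: Ck_exp; apply: Ck_add; [exact: Ck_coord|exact: Ck_cst].
have cf : Ck 1 f.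
  apply: Ck_add => //; apply: Ck_mul; first exact: Ck_cst.
  by apply: Ck_sum => i; exact: cb.
have df k y : partial k f y = 0.
  have d := is_derive_add (dC k y cw)
    (is_derive_mul (is_derive_const (- (P 0 / 8)) y (delta_mx 0 k))
      (is_derive_bigsum (fun i => is_derive_exp 1
         (is_derive_add (is_derive_coord y k i) (is_derive_const (- a 0 i) y (delta_mx 0 k)))))).
  rewrite (partial_val d) gradient_w mul0r add0r (bigD1 k)//.
  rewrite big1; last by move=> i ik; rewrite (negbTE ik) addr0 mulr0.
  by rewrite eqxx /= !addr0 expr1; move: (P 0) (y 0 k) (a 0 k) => p b c; field.
have := partial0_const cf df x a; rewrite /f.
have -> : \sum_i (a 0 i + - a 0 i) ^+ 2 = 0 by apply: big1 => i _; rewrite subrr expr0n.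
rewrite mulr0 addr0 => /eqP; rewrite mulNr subr_eq addrC => /eqP ->; congr (_ + _).
have := w_lap_w a; rewrite laplacian_w_const big1 => [|i _]; last first.
  by rewrite gradient_w subrr mulr0 expr0n.
by rewrite mulr0 add0r => <-; rewrite mulfK.
Qed.

Lemma v_bubble : exists (x0 : 'rV[R]_4) (delta : R), 0 < delta /\ v = bubble delta x0.
Proof.
(* Matching w with (|x - a|^2 + delta^2) / (2 delta) asks for 1 / (2 delta) = P(0)/8 and delta / 2 =
   2 / P(0), both solved by delta = 4 / P(0). *)
exists a, (4 / P 0); split; first by rewrite divr_gt0.
apply/funext => x; rewrite /bubble /enorm sqr_sqrtr; last first.
  by apply: sumr_ge0 => i _; exact: sqr_ge0.
rewrite -[v x]invrK -/(w x) w_quadratic.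
have -> : \sum_i (x - a) 0 i ^+ 2 = \sum_i (x 0 i - a 0 i) ^+ 2.
  by apply: eq_bigr => i _; rewrite !mxE.
have : 0 <= \sum_i (x 0 i - a 0 i) ^+ 2 by apply: sumr_ge0 => i _; exact: sqr_ge0.
move: (\sum_i _) (P_gt0 0); move: (P 0) => p s p0 s0.
have h1 : 0 < p / 8 * s + 2 / p by rewrite ltr_wpDl ?mulr_ge0 ?divr_gt0// ltW// divr_gt0.
have h2 : 0 < (4 / p) ^+ 2 + s by rewrite ltr_pwDl// exprn_gt0// divr_gt0.
apply: (mulIf (lt0r_neq0 h2)); apply: (mulfI (lt0r_neq0 h1)).
rewrite mulVKf ?divfK ?lt0r_neq0//; last first.
by field; rewrite gt_eqF.
Qed.

End Liouville.

Theorem corollary3p2 (R : realType) (v : 'rV[R]_4 -> R)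
    (v_smooth : smooth v)
    (v_pos : forall x : 'rV[R]_4, 0 < v x)
    (v_eq : forall x : 'rV[R]_4, laplacian v x = - 2 * v x ^+ 3) :
  exists (x0 : 'rV[R]_4) (delta : R), 0 < delta /\ v = bubble delta x0.
Proof.
apply: v_bubble v_pos _ => [m|x]; first exact: smooth_Ck.
rewrite -v_eq /laplacian /divergence; apply: eq_bigr => k _.
by congr (partial k _ x); apply/funext => y; rewrite /grad mxE.
Qed.
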